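(* Let $c\in\{0,1\}$ and let $t$ be an odd integer such that $2c+1\le t\le 7$. Then the set $$\{f\in\mathrm{Sym}^3(\mathbb{R}^3)\ :\ f \text{ has } c \text{ ovals},\ \#\{\text{real eigenvectors of } f\}=t\}$$ has positive volume.
   Context: $\mathrm{Sym}^3(\mathbb{R}^3)$ denotes the real vector space of homogeneous polynomials of degree $3$ in three variables $x,y,z$ with real coefficients, identified with $\mathbb{R}^{10}$ via coefficients; volume means Lebesgue measure. A real eigenvector of $f$ is a nonzero vector $v\in\mathbb{R}^3$ such that $\nabla f(v)=\lambda v$ for some $\lambda\in\mathbb{R}$ ($\lambda=0$ is allowed); eigenvectors are counted up to nonzero real scalar multiples, i.e. as points of $\mathbb{P}^2(\mathbb{R})$. ''$f$ has $c$ ovals'' means: $f\neq 0$ and the real zero locus $\{f=0\}\subset\mathbb{P}^2(\mathbb{R})$ is the disjoint union of exactly $c$ ovals and one pseudo-line, where an oval is an embedded circle in $\mathbb{P}^2(\mathbb{R})$ whose complement is disconnected, and a pseudo-line is an embedded circle whose complement is connected. *)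

(* Defs.v *)
From HB Require Import structures.
From mathcomp Require Import all_boot all_order all_algebra generic_quotient.
(* The notations of mpoly clash with those of mathcomp-analysis. *)
From mathcomp Require Import -(notations) mpoly.
From mathcomp Require Import all_classical all_reals all_analysis.
Import Order.TTheory GRing.Theory Num.Theory.
Import numFieldNormedType.Exports.

Set Implicit Arguments.
Unset Strict Implicit.
Unset Printing Implicit Defensive.

Local Open Scope classical_set_scope.
Local Open Scope ring_scope.

(* The library only has binary products of measures; [tuple_power mu n] is the
   n-fold product of [mu], on the product sigma-algebra of n-tuples. *)
Section TuplePower.
Context d (T : measurableType d) (R : realType).

Definition cons_pair n (p : T * n.-tuple T) : n.+1.-tuple T :=
  [tuple of p.1 :: p.2].

Lemma measurable_cons_pair n : measurable_fun setT (@cons_pair n).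
Proof. exact: measurable_cons. Qed.

Section step.
Context (mu : {sigma_finite_measure set T -> \bar R}) (n : nat).
Context (nu : {sigma_finite_measure set (n.-tuple T) -> \bar R}).

Definition tuple_power_step : set (n.+1.-tuple T) -> \bar R :=
  pushforward (mu \x nu)%E (@cons_pair n).

Let step0 : tuple_power_step set0 = 0%E.
Proof. by rewrite /tuple_power_step /pushforward preimage_set0 measure0. Qed.

Let step_ge0 A : (0 <= tuple_power_step A)%E.
Proof. by rewrite /tuple_power_step /pushforward measure_ge0. Qed.

Let step_sigma_additive : semi_sigma_additive tuple_power_step.
Proof.
exact: (measure_semi_sigma_additive
  (s := measure_function_pushforward__canonical__measure_function_Measure
     (mu \x nu)%E (@measurable_cons_pair n))).
Qed.

HB.instance Definition _ := isMeasure.Build _ _ _ tuple_power_step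
  step0 step_ge0 step_sigma_additive.

Let step_sigma_finite : sigma_finite setT tuple_power_step.
Proof.
have /sigma_finiteP[F [TF ndF Foo]] := sigma_finiteT mu.
have /sigma_finiteP[G [TG ndG Goo]] := sigma_finiteT nu.
pose u (t : n.+1.-tuple T) : T * n.-tuple T := (thead t, [tuple of behead t]).
have measurable_u : measurable_fun setT u.
  apply/measurable_fun_pairP; split; first exact: measurable_tnth.
  exact: measurable_behead.
have cons_pairK : cancel (@cons_pair n) u.
  by move=> [x t]; rewrite /u /cons_pair theadE; congr pair; exact/val_inj.
exists (fun k => u @^-1` (F k `*` G k)).
  rewrite -preimage_bigcup (_ : \bigcup_k _ = setT) ?preimage_setT//.
  apply/seteqP; split=> // -[x y] _.
  have [k _ Fkx] : (\bigcup_k F k) x by rewrite -TF.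
  have [l _ Gly] : (\bigcup_l G l) y by rewrite -TG.
  exists (maxn k l) => //; split.
  - by move: x Fkx; exact/subsetPset/ndF/leq_maxl.
  - by move: y Gly; exact/subsetPset/ndG/leq_maxr.
move=> k; have [mF Flt] := Foo k; have [mG Glt] := Goo k; split.
  rewrite -[X in measurable X]setTI; apply: measurable_u => //.
  exact: measurableX.
rewrite /tuple_power_step /pushforward -comp_preimage.
rewrite (_ : u \o _ = id); last by apply/funext => p /=; rewrite cons_pairK.
by rewrite [X in (X < _)%E]product_measure1E// lte_mul_pinfty// ge0_fin_numE.
Qed.

HB.instance Definition _ := Measure_isSigmaFinite.Build _ _ _ tuple_power_step
  step_sigma_finite.

End step.

Fixpoint tuple_power (mu : {sigma_finite_measure set T -> \bar R}) n :
    {sigma_finite_measure set (n.-tuple T) -> \bar R} :=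
  if n is n'.+1 then tuple_power_step mu (tuple_power mu n')
  else \d_([tuple] : 0.-tuple T).

End TuplePower.

Definition lebesgue_tuple (R : realType) (n : nat) :
    {sigma_finite_measure set (n.-tuple (measurableTypeR R)) -> \bar R} :=
  tuple_power (@lebesgue_measure R) n.

Section ProjectivePlane.
Context (R : realType).

Definition nonzero_vector : set 'rV[R]_3 := [set v | v != 0].

Definition proportional (v w : nonzero_vector) : bool :=
  `[< exists2 k : R, k != 0 & val w = k *: val v >].

Lemma proportional_refl : reflexive proportional.
Proof. by move=> v; apply/asboolP; exists 1; rewrite ?oner_eq0 ?scale1r. Qed.

Lemma proportional_sym : ssrbool.symmetric proportional.
Proof.
suff sub v w : proportional v w -> proportional w v.
  by move=> v w; apply/idP/idP; exact: sub.
move=> /asboolP[k k0 wE]; apply/asboolP; exists k^-1; first by rewrite invr_eq0.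
by rewrite wE scalerA mulVf ?scale1r.
Qed.

Lemma proportional_trans : transitive proportional.
Proof.
move=> w v u /asboolP[k k0 wE] /asboolP[l l0 uE]; apply/asboolP.
by exists (l * k); rewrite ?mulf_neq0// uE wE scalerA.
Qed.

Canonical proportional_equiv :=
  EquivRel proportional proportional_refl proportional_sym proportional_trans.

(* [quotient_topology] makes P^2(R) a topological quotient of R^3 \ {0}. *)
Definition projective_plane :=
  quotient_topology {eq_quot proportional_equiv}%qT.

HB.instance Definition _ := Topological.on projective_plane.
HB.instance Definition _ := Quotient.on projective_plane.

Definition proj_point (v : nonzero_vector) : projective_plane :=
  (\pi_projective_plane v)%qT.

End ProjectivePlane.
Arguments nonzero_vector : clear implicits.

Section Circles.
Context (R : realType).

Definition unit_circle : set (R * R) := [set p | p.1 ^+ 2 + p.2 ^+ 2 = 1].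

(* [h] restricts to a homeomorphism from the circle onto [C] with inverse [g];
   the values of [h] and [g] elsewhere are irrelevant. *)
Definition embedded_circle (X : topologicalType) (C : set X) : Prop :=
  exists (h : R * R -> X) (g : X -> R * R),
    [/\ {within unit_circle, continuous h}, {within C, continuous g},
        h @` unit_circle = C & {in unit_circle, cancel h g}].

Definition oval (C : set (projective_plane R)) : Prop :=
  embedded_circle C /\ ~ connected (~` C).

Definition pseudo_line (C : set (projective_plane R)) : Prop :=
  embedded_circle C /\ connected (~` C).

End Circles.

Section TernaryCubics.
Context (R : realType).

Definition ternary_cubic := dhomog 3 R 3.

Definition zero_locus (f : ternary_cubic) : set (projective_plane R) :=
  @proj_point R @` [set v : nonzero_vector R | meval (val v 0) (f : mpoly 3 R) = 0].

Definition has_ovals (c : nat) (f : ternary_cubic) : Prop :=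
  f != 0 /\
  exists (O : 'I_c -> set (projective_plane R)) (L : set (projective_plane R)),
    [/\ forall i, oval (O i), pseudo_line L,
        trivIset setT O, forall i, O i `&` L = set0
      & zero_locus f = (\bigcup_i O i) `|` L].

Definition gradient (f : ternary_cubic) (v : 'rV[R]_3) : 'rV[R]_3 :=
  \row_i meval (v 0) (mderiv i (f : mpoly 3 R)).

Definition eigenpoints (f : ternary_cubic) : set (projective_plane R) :=
  @proj_point R @`
    [set v : nonzero_vector R | exists lambda : R, gradient f (val v) = lambda *: val v].

Definition exponent (i j k : nat) : multinom 3 := Multinom [tuple i; j; k].

Definition coefficients (f : ternary_cubic) : 10.-tuple (measurableTypeR R) :=
  let a i j k : R := mcoeff (exponent i j k) (f : mpoly 3 R) in
  [tuple a 3 0 0; a 2 1 0; a 2 0 1; a 1 2 0; a 1 1 1;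
         a 1 0 2; a 0 3 0; a 0 2 1; a 0 1 2; a 0 0 3]%N.

(* The measures of the library are only meaningful on measurable sets (here,
   Borel sets).  For a Lebesgue measurable set, in particular for a semialgebraic
   one, having positive Lebesgue measure is the same as containing a Borel set of
   positive measure; for any other set the latter is the stronger requirement
   compared with positive outer measure. *)
Definition positive_volume (S : set ternary_cubic) : Prop :=
  exists A : set (10.-tuple (measurableTypeR R)),
    [/\ measurable A, A `<=` coefficients @` S & (0 < lebesgue_tuple R 10 A)%E].

End TernaryCubics.

(* Main.v *)
From HB Require Import structures.
Require Import Defs.
From mathcomp Require Import all_boot all_order all_algebra generic_quotient.
From mathcomp Require Import -(notations) mpoly.
From mathcomp Require Import all_classical all_reals all_analysis.
From mathcomp Require Import ring lra.

Import Order.TTheory GRing.Theory Num.Theory.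
Import numFieldNormedType.Exports.

Set Implicit Arguments.
Unset Strict Implicit.
Unset Printing Implicit Defensive.

Local Open Scope classical_set_scope.
Local Open Scope ring_scope.

(** The idea is to exhibit one cubic f0 for each pair (c, t) such that both
    properties persist for every cubic whose ten coefficients are close to those
    of f0; a box in the space of coefficients then has positive volume.

    Topology of the zero locus. All cubics are looked at from the point
    [0 : 0 : 1], which stays off the curve, along the lines that join it to
    [x : y : 0]. If df/dz is positive away from the origin, then f is increasing
    in z, every such line carries exactly one real point of the curve, and the
    curve is the graph of a continuous odd function of (x, y)
    ([has_no_oval]). If f < 0 at height 1 and f > 0 at height 4 over the unit
    circle, then, f being odd, there are three roots on every line, separated by
    the heights -1 and 1. The middle one is odd and the smallest is the antipode
    of the largest, so that the curve consists of the graph of an odd function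
    and of the graph of the largest root ([has_one_oval]). The graph of an odd
    function is a pseudo-line, since its complement is star-shaped about
    [0 : 0 : 1] ([pseudo_line_graph]); the graph of a function that stays above
    its antipode is an oval, since it separates the points above it from those
    between it and its antipode ([oval_graph]). Both hypotheses on f are strict
    inequalities on compact sets, so that they persist under perturbation.

    Number of eigenpoints. In the chart z = 1 the eigenpoints are the common
    zeros of f_x - x f_z and f_y - y f_z. Suppose that f0 has m eigenpoints, all
    in the chart and all nondegenerate. A quantitative inverse function theorem
    ([parametrized_zero]) gives for nearby cubics exactly one eigenpoint in a
    small square around each of them, and compactness of the sphere forbids any
    other, because an eigenvector is a zero of the cross product of v and
    grad f (v) ([near_card_eigenpoints]).

    The cubics. The family z^3 + z (al x^2 + be y^2) + x (ga x^2 + de y^2)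
    contains examples for all seven pairs (c, t) whose eigenpoints are rational
    and found by hand. Positive al and be give no oval; one oval is obtained from
    negative al and be and suitable ga and de. *)

(** * Volume of boxes *)

Section BoxVolume.
Context (R : realType).

Definition box n (a : n.-tuple R) (e : R) : set (n.-tuple R) :=
  [set t | forall i, `|tnth t i - tnth a i| < e].

Let interval (x e : R) : set R := [set y | `|y - x| < e].

Lemma intervalE x e : interval x e = `](x - e), (x + e)[%classic.
Proof.
by apply/seteqP; split=> y; rewrite /interval /= in_itv/= ltr_norml; lra.
Qed.

Lemma measurable_box n (a : n.-tuple R) e :
  measurable (box a e : set (n.-tuple (measurableTypeR R))).
Proof.
rewrite (_ : box a e =
  \bigcap_(i : 'I_n) ((@tnth n R)^~ i @^-1` interval (tnth a i) e)); last first.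
  by apply/seteqP; split=> [t ta i _|t ta i]; apply: ta.
apply: fin_bigcap_measurable => // i _.
rewrite -[X in measurable X]setTI; apply: measurable_tnth => //.
by rewrite intervalE; exact: measurable_itv.
Qed.

Lemma box_volume_gt0 n (a : n.-tuple R) e : 0 < e ->
  (0 < lebesgue_tuple R n (box a e))%E.
Proof.
move=> e0; elim: n a => [|n IHn] a.
  rewrite /lebesgue_tuple /= diracE mem_set ?lte01// => -[]//.
have [x [b ->]] : exists x (b : n.-tuple R), a = [tuple of x :: b].
  by exists (thead a), [tuple of behead a]; rewrite -tuple_eta.
rewrite /lebesgue_tuple /= /tuple_power_step /pushforward.
rewrite (_ : _ @^-1` _ = interval x e `*` box b e); last first.
  apply/seteqP; split=> -[y t] /=.
    move=> h; split; first exact: (h ord0).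
    by move=> i; have := h (lift ord0 i); rewrite !tnthS.
  move=> [yx tb] i; case: (unliftP ord0 i) => [j|] ->; first by rewrite !tnthS.
  exact: yx.
rewrite [X in (_ < X)%E]product_measure1E; last first.
- exact: measurable_box.
- by rewrite intervalE; exact: measurable_itv.
apply: mule_gt0; last exact: IHn.
have : (0 < @lebesgue_measure R (`](x - e)%R, (x + e)%R[))%E.
  by rewrite lebesgue_measure_itv /= lte_fin ifT -?EFinD ?lte_fin; lra.
by rewrite -intervalE.
Qed.

End BoxVolume.

(** * The projective plane in homogeneous coordinates *)

Section Plane.
Context (R : realType).
Notation P2 := (projective_plane R).

Definition vec (x y z : R) : 'rV[R]_3 := \row_i [:: x; y; z]`_i.

Lemma vecE x y z :
  (vec x y z 0 0 = x) * (vec x y z 0 1 = y) * (vec x y z 0 2%R = z).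
Proof. by rewrite !mxE. Qed.

Lemma vec_eta (v : 'rV[R]_3) : v = vec (v 0 0) (v 0 1) (v 0 2%R).
Proof.
apply/rowP => -[[|[|[|//]]] i3]; rewrite mxE/=; congr (v _ _);
  exact: val_inj.
Qed.

Lemma vec_inj x y z x' y' z' :
  vec x y z = vec x' y' z' -> [/\ x = x', y = y' & z = z'].
Proof.
by move=> /rowP e; have := (e 0, e 1, e 2%R); rewrite !vecE => -[[-> ->] ->].
Qed.

Lemma vecZ k x y z : k *: vec x y z = vec (k * x) (k * y) (k * z).
Proof. by apply/rowP => -[[|[|[|//]]] i3]; rewrite !mxE. Qed.

Lemma vec0 : vec 0 0 0 = 0.
Proof. by apply/rowP => -[[|[|[|//]]] i3]; rewrite !mxE. Qed.

Lemma vec_neq0 x y z : (vec x y z != 0) = [|| x != 0, y != 0 | z != 0].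
Proof.
rewrite -vec0; apply/idP/idP; last first.
  by apply: contraTN => /eqP /vec_inj[-> -> ->]; rewrite eqxx.
by apply: contraNT; rewrite !negb_or !negbK => /and3P[/eqP-> /eqP-> /eqP->].
Qed.

Fact default_vector : nonzero_vector R.
Proof. by exists (vec 0 0 1); rewrite inE /nonzero_vector/= vec_neq0 oner_eq0 !orbT. Qed.

(** [point 0] is a junk value, which lets the projection be a total function on
    the normed space of row vectors. *)
Definition point (v : 'rV[R]_3) : P2 := proj_point (insubd default_vector v).

Lemma val_insubd_neq0 v : v != 0 -> val (insubd default_vector v) = v.
Proof. by move=> v0; rewrite insubdK// mem_set. Qed.

Lemma proj_pointE (v : nonzero_vector R) : proj_point v = point (val v).
Proof. by rewrite /point valKd. Qed.

Lemma nonzero_val (v : nonzero_vector R) : val v != 0.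
Proof. by case: v => v v0; exact: (set_mem v0). Qed.

Lemma pointP (p : P2) : exists2 v, v != 0 & p = point v.
Proof.
exists (val (repr p)); first exact: nonzero_val.
by rewrite -proj_pointE /proj_point reprK.
Qed.

Lemma eq_pointP v w : v != 0 -> w != 0 ->
  point v = point w <-> exists2 k, k != 0 & w = k *: v.
Proof.
move=> v0 w0; rewrite /point /proj_point.
transitivity (proportional (insubd default_vector v) (insubd default_vector w)).
  by split=> [/eqmodP//|h]; apply/eqmodP.
by split=> [/asboolP|h]; [|apply/asboolP]; rewrite !val_insubd_neq0.
Qed.

Lemma pointZ k v : k != 0 -> v != 0 -> point (k *: v) = point v.
Proof.
move=> k0 v0; apply/esym/eq_pointP => //; last by exists k.
by rewrite scaler_eq0 negb_or k0.
Qed.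

Lemma open_point_preimage (U : set P2) : open U ->
  open [set v | v != 0 /\ U (point v)].
Proof.
move=> [W oW WU].
rewrite (_ : [set v | _ ] = W `&` [set v | v != 0]); last first.
  apply/seteqP; split=> v /=.
    move=> [v0 Uv]; split=> //.
    have : (\pi_P2%qT @^-1` U) (insubd default_vector v) by [].
    by rewrite -WU /= -[set_val _]/(val _) val_insubd_neq0.
  move=> [Wv v0]; split=> //.
  suff: (\pi_P2%qT @^-1` U) (insubd default_vector v) by [].
  by rewrite -WU /= -[set_val _]/(val _) val_insubd_neq0.
apply: openI => //.
rewrite (_ : [set v | _ ] = ~` [set 0]); last first.
  by apply/seteqP; split=> v /= /eqP.
by rewrite openC; exact/accessible_closed_set1/hausdorff_accessible/norm_hausdorff.
Qed.

Lemma near_neq0 (w : 'rV[R]_3) : w != 0 -> \forall v \near w, v != 0.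
Proof.
have := open_point_preimage openT; rewrite openE => h w0.
have : nbhs w [set v | v != 0 /\ (setT : set P2) (point v)] by exact: h.
by apply: filterS => v [].
Qed.

Lemma point_cvg (T : Type) (F : set_system T) (v : T -> 'rV[R]_3)
    (w : 'rV[R]_3) :
  Filter F -> w != 0 -> v @ F --> w -> point (v t) @[t --> F] --> point w.
Proof.
move=> FF w0 vw U; rewrite nbhsE => -[V [oV Vw] VU].
have : nbhs w [set v | v != 0 /\ V (point v)].
  have h := open_point_preimage oV; rewrite openE in h; exact: h.
by move=> /vw h; apply: (filterS (F := F) _ h) => t [_ /VU].
Qed.

(** The cone over an open set is a union of dilates of it, hence open. *)
Lemma open_point (W : set 'rV[R]_3) : open W ->
  open (point @` (W `&` [set v | v != 0])).
Proof.
move=> oW.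
exists (\bigcup_(k in [set k : R | k != 0]) ((fun v => k *: v) @^-1` W)).
  apply: bigcup_open => k _; apply: open_comp => // v _.
  exact: scaler_continuous.
apply/seteqP; split=> v /=.
  move=> [k k0 /= Wv]; exists (k *: val v).
    by split=> //=; rewrite scaler_eq0 negb_or k0 nonzero_val.
  by rewrite pointZ ?nonzero_val// -proj_pointE.
move=> [w [Ww w0]] wv.
have /(eq_pointP (nonzero_val v) w0)[k k0 wE] : point (val v) = point w.
  by rewrite wv -proj_pointE.
by exists k => //=; rewrite -[set_val v]/(val v) -wE.
Qed.

(** The projection being open, continuity on the plane can be tested on
    homogeneous coordinates. *)
Lemma continuous_at_point (Z : topologicalType) (g : P2 -> Z)
    (w : 'rV[R]_3) : w != 0 ->
  {for w, continuous (g \o point)} -> {for point w, continuous g}.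
Proof.
move=> w0 gc U; rewrite /= => gU.
have : nbhs w ((g \o point) @^-1` U) by exact: gc.
rewrite nbhsE => -[W [oW Ww] WU].
apply: (filterS (P := point @` (W `&` [set v | v != 0]))).
  by move=> _ [v [Wv _] <-]; exact: WU.
by apply: open_nbhs_nbhs; split; [exact: open_point|exists w].
Qed.

Lemma cvg_vec (T : Type) (F : set_system T) (x y z : T -> R) a b c :
  Filter F -> x @ F --> a -> y @ F --> b -> z @ F --> c ->
  vec (x t) (y t) (z t) @[t --> F] --> vec a b c.
Proof.
move=> FF xa yb zc; apply/cvg_ballP => e e0.
move: xa yb zc => /cvg_ballP/(_ _ e0) xa /cvg_ballP/(_ _ e0) yb /cvg_ballP/(_ _ e0) zc.
apply: filterS3 xa yb zc => t xa yb zc; rewrite /ball/=; split=> // i [[|[|[|//]]] ?].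
all: by rewrite !mxE.
Qed.

End Plane.
Arguments point {R} v.

(** * Limits and neighbourhoods *)

Section CvgProj.
Context (T : Type) (F : set_system T) {FF : Filter F}.

Lemma cvg_coord (K : numFieldType) m n (i : 'I_m) (j : 'I_n)
    (v : T -> 'M[K]_(m, n)) (w : 'M[K]_(m, n)) :
  v @ F --> w -> v t i j @[t --> F] --> w i j.
Proof. by move=> vw A /(@coord_continuous _ _ _ i j w) /vw. Qed.

Lemma cvg_proj1 (U V : topologicalType) (h : T -> U * V) (p : U * V) :
  h @ F --> p -> (h t).1 @[t --> F] --> p.1.
Proof. by move=> hp; exact: (cvg_comp _ _ hp cvg_fst). Qed.

Lemma cvg_proj2 (U V : topologicalType) (h : T -> U * V) (p : U * V) :
  h @ F --> p -> (h t).2 @[t --> F] --> p.2.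
Proof. by move=> hp; exact: (cvg_comp _ _ hp cvg_snd). Qed.

Lemma cvg_mkpair (U V : topologicalType) (f : T -> U) (g : T -> V) a b :
  f @ F --> a -> g @ F --> b -> (f t, g t) @[t --> F] --> ((a, b) : U * V).
Proof. by move=> fa gb; exact: cvg_pair fa gb. Qed.

End CvgProj.


Section NearOrder.
Context (R : realType) (T : topologicalType) (f : T -> R) (p : T).
Hypothesis fp : {for p, continuous f}.

Lemma near_lt c : f p < c -> \forall q \near p, f q < c.
Proof. by move=> h; have := cvgr_lt _ fp _ h; apply. Qed.

Lemma near_gt c : c < f p -> \forall q \near p, c < f q.
Proof. by move=> h; have := cvgr_gt _ fp _ h; apply. Qed.

Lemma near_neq c : f p != c -> \forall q \near p, f q != c.
Proof.
by rewrite neq_lt => /orP[/near_lt|/near_gt]; apply: filterS => q h;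
  [rewrite lt_eqF|rewrite gt_eqF].
Qed.

End NearOrder.

Lemma open_lt_fun (R : realType) (T : topologicalType) (f g : T -> R) :
  continuous f -> continuous g -> open [set p | f p < g p].
Proof.
move=> fc gc.
rewrite (_ : [set p | _] = (fun p => g p - f p) @^-1` [set r | 0 < r]).
  apply: open_comp; last exact: open_gt.
  by move=> p _; apply: cvgB; [exact: gc|exact: fc].
by apply/seteqP; split=> p /=; rewrite subr_gt0.
Qed.

Lemma nbhsI (T : topologicalType) (p : T) (A B : set T) :
  nbhs p A -> nbhs p B -> nbhs p (A `&` B).
Proof. exact: filterI. Qed.

(** Proves that an expression built from sums, products, coordinates and pairs
    is continuous. The functions and the filter are passed explicitly because
    their inference by unification unfolds the neighbourhood filters of product
    spaces. *)
Ltac prove_cvg :=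
  rewrite /prop_for /continuous_at;
  repeat (cbv beta;
    lazymatch goal with
    | |- cvg_to (nbhs (fmap (fun t => @?f t + @?g t) ?F)) _ =>
        apply: (cvgD (F := F) (f := f) (g := g))
    | |- cvg_to (nbhs (fmap (fun t => @?f t * @?g t) ?F)) _ =>
        apply: (cvgM (F := F) (f := f) (g := g))
    | |- cvg_to (nbhs (fmap (fun t => - @?f t) ?F)) _ => apply: (cvgN (F := F) (f := f))
    | |- cvg_to (nbhs (fmap (fun t => fun_of_matrix (@?f t) _ _) ?F)) _ =>
        apply: (cvg_coord (F := F) (v := f))
    | |- cvg_to (nbhs (fmap (fun t => vec (@?f t) (@?g t) (@?h t)) ?F)) _ =>
        apply: (cvg_vec (F := F) (x := f) (y := g) (z := h))
    | |- cvg_to (nbhs (fmap (fun t => fst (@?f t)) ?F)) _ => apply: (cvg_proj1 (F := F) (h := f))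
    | |- cvg_to (nbhs (fmap (fun t => snd (@?f t)) ?F)) _ => apply: (cvg_proj2 (F := F) (h := f))
    | |- cvg_to (nbhs (fmap (fun t => (@?f t, @?g t)) ?F)) _ =>
        apply: (cvg_mkpair (F := F) (f := f) (g := g))
    | |- cvg_to (nbhs (fmap (fun t => t) ?F)) _ => exact: (@cvg_id _ F)
    | |- cvg_to (nbhs (fmap (fun t => ?c) ?F)) _ => exact: (@cvg_cst _ _ _ F _)
    end); try eassumption.

(** * Graphs over the lines through [0 : 0 : 1] *)

Section Graphs.
Context (R : realType).
Notation P2 := (projective_plane R).
Implicit Types (phi : R -> R -> R) (v w : 'rV[R]_3) (k x y z : R).

Definition graph phi : set P2 :=
  [set P | exists x y, (x != 0) || (y != 0) /\ P = point (vec x y (phi x y))].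

Lemma sqr_sum_gt0 x y : (x != 0) || (y != 0) -> 0 < x ^+ 2 + y ^+ 2.
Proof.
move=> /orP[] h.
  by rewrite ltr_pwDl ?sqr_ge0// exprn_even_gt0.
by rewrite ltr_wpDl ?sqr_ge0// exprn_even_gt0.
Qed.

Lemma unit_circle_sqr (q : R * R) :
  unit_circle q -> q.2 ^+ 2 = (1 + q.1) * (1 - q.1).
Proof. rewrite /unit_circle/= => qC; lra. Qed.

Section Descent.
Context (Z : topologicalType) (g : 'rV[R]_3 -> Z).
Hypothesis gZ : forall k v, k != 0 -> v != 0 -> g (k *: v) = g v.

Definition descend (P : P2) : Z := g (val (repr P)).

Lemma descendE v : v != 0 -> descend (point v) = g v.
Proof.
move=> v0; rewrite /descend.
have r0 := nonzero_val (repr (point v)).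
have /(eq_pointP v0 r0)[k k0 ->] : point v = point (val (repr (point v))).
  by rewrite -proj_pointE /proj_point reprK.
exact: gZ.
Qed.

Lemma descend_continuous w : w != 0 -> {for w, continuous g} ->
  {for point w, continuous descend}.
Proof.
move=> w0 gw; apply: continuous_at_point => //.
rewrite /prop_for /continuous_at /= descendE//.
have E : {near nbhs w, g =1 descend \o point}.
  by have := near_neq0 w0; apply: filterS => v v0 /=; rewrite descendE.
exact: (cvg_trans (near_eq_cvg E) gw).
Qed.

End Descent.

Lemma within_continuous_at (X Y : topologicalType) (A : set X) (g : X -> Y) :
  (forall p, A p -> {for p, continuous g}) -> {within A, continuous g}.
Proof.
move=> gc; apply/subspace_continuousP => p Ap.
by apply: cvg_within_filter; exact: gc.
Qed.

Lemma graph_point_continuous phi (q : R * R) :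
  (q.1 != 0) || (q.2 != 0) ->
  {for q, continuous (fun q => phi q.1 q.2)} ->
  {for q, continuous (fun q : R * R => point (vec q.1 q.2 (phi q.1 q.2)))}.
Proof.
move=> q0 phic; apply: (point_cvg (F := nbhs q)); first by rewrite vec_neq0 orbA q0.
prove_cvg; exact: phic.
Qed.

Section PseudoLine.
Variable phi : R -> R -> R.
Hypothesis phiZ : forall k x y, k != 0 -> (x != 0) || (y != 0) ->
  phi (k * x) (k * y) = k * phi x y.
Hypothesis phi_continuous : forall q : R * R, (q.1 != 0) || (q.2 != 0) ->
  {for q, continuous (fun q => phi q.1 q.2)}.

Let pt (q : R * R) := point (vec q.1 q.2 (phi q.1 q.2)).

Lemma in_odd_graph x y z : vec x y z != 0 ->
  graph phi (point (vec x y z)) <-> (x != 0) || (y != 0) /\ z = phi x y.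
Proof.
move=> v0; split=> [[x' [y' [xy0]]]|[xy0 ->]]; last by exists x, y.
move=> /(eq_pointP v0); rewrite vec_neq0 orbA xy0 => /(_ isT)[k k0].
rewrite vecZ => /vec_inj[xE yE zE].
have xy : (x != 0) || (y != 0).
  by move: xy0; rewrite xE yE !mulf_eq0 !(negbTE k0).
split=> //; apply: (mulfI k0).
by rewrite -zE xE yE phiZ.
Qed.

Let ptZ k q : k != 0 -> (q.1 != 0) || (q.2 != 0) ->
  pt (k * q.1, k * q.2) = pt q.
Proof.
move=> k0 q0; rewrite /pt /= phiZ// -vecZ pointZ//.
by rewrite vec_neq0 orbA q0.
Qed.

(* For a = cos 2t and b = sin 2t, both (1 + a, b) and (b, 1 - a) are multiples
   of (cos t, sin t), and at least one of them is nonzero. *)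
Let u1 (q : R * R) := (1 + q.1, q.2).
Let u2 (q : R * R) := (q.2, 1 - q.1).
Let h (q : R * R) := if q.1 == -1 then pt (u2 q) else pt (u1 q).
Let double v : R * R :=
  ((v 0 0 * v 0 0 - v 0 1 * v 0 1) / (v 0 0 * v 0 0 + v 0 1 * v 0 1),
   2 * (v 0 0 * v 0 1) / (v 0 0 * v 0 0 + v 0 1 * v 0 1)).

Let doubleZ k v : k != 0 -> v != 0 -> double (k *: v) = double v.
Proof.
move=> k0 _; rewrite /double !mxE; set x := v 0 0; set y := v 0 1.
have -> : k * x * (k * x) + k * y * (k * y) = k ^+ 2 * (x * x + y * y) by ring.
move: (x * x + y * y) => n; have [->|n0] := eqVneq n 0; first by rewrite mulr0 invr0 !mulr0.
by congr (_, _); field; rewrite n0.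
Qed.

Let subN1_neq0 (a : R) : a = -1 -> 1 - a != 0.
Proof. by move=> ->; rewrite opprK -[1 + 1]/(2%:R) pnatr_eq0. Qed.

Let hE2 q : unit_circle q -> q.1 != 1 -> h q = pt (u2 q).
Proof.
rewrite /h => qC q1; case: ifPn => // qN1.
have a0 : 1 + q.1 != 0 by rewrite addrC addr_eq0.
have qE := unit_circle_sqr qC.
have b0 : q.2 != 0.
  apply/eqP => b0; move: qE; rewrite b0 expr0n/= => /esym/eqP.
  by rewrite mulf_eq0 (negbTE a0)/= subr_eq0 eq_sym (negbTE q1).
rewrite -(@ptZ (q.2 / (1 + q.1)) (u1 q)) ?mulf_neq0 ?invr_eq0//=; last by rewrite a0.
congr (pt (_, _)); first by field.
by rewrite mulrAC -expr2 qE; field.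
Qed.

Let h_continuous : {within @unit_circle R, continuous h}.
Proof.
apply/subspace_continuousP => q qC; rewrite /from_subspace.
have [qN1|qN1] := eqVneq q.1 (-1).
  rewrite hE2//; last by rewrite qN1 -subr_eq0; lra.
  apply: (@cvg_trans _ (pt (u2 p) @[p --> within (@unit_circle R) (nbhs q)])).
    apply: near_eq_cvg; rewrite near_withinE.
    have : \forall p \near q, p.1 < 1.
      by apply: (near_lt (f := fun p : R * R => p.1)); [prove_cvg|rewrite qN1; lra].
    by apply: filterS => p p1 pC; rewrite hE2// lt_eqF.
  apply: cvg_within_filter.
  have uc : {for q, continuous u2} by rewrite /u2; prove_cvg.
  apply: (continuous_comp (g := pt) uc).
  have u0 : ((u2 q).1 != 0) || ((u2 q).2 != 0).
    by rewrite /= subN1_neq0// orbT.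
  exact/graph_point_continuous/phi_continuous.
have a0 : 1 + q.1 != 0 by rewrite addrC addr_eq0.
rewrite {2}/h (negbTE qN1).
apply: (@cvg_trans _ (pt (u1 p) @[p --> within (@unit_circle R) (nbhs q)])).
  apply: near_eq_cvg; rewrite near_withinE.
  have : \forall p \near q, p.1 != -1.
    by apply: (near_neq (f := fun p : R * R => p.1)); [prove_cvg|].
  by apply: filterS => p p1 pC; rewrite /h (negbTE p1).
apply: cvg_within_filter.
have uc : {for q, continuous u1} by rewrite /u1; prove_cvg.
  apply: (continuous_comp (g := pt) uc).
have u0 : ((u1 q).1 != 0) || ((u1 q).2 != 0) by rewrite /= a0.
exact/graph_point_continuous/phi_continuous.
Qed.

(* The inverse doubles the angle of the direction (x, y), which is determined
   up to sign by a point of the graph. *)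
Let embedded : embedded_circle R (graph phi).
Proof.
exists h, (descend double); split.
- exact: h_continuous.
- apply: within_continuous_at => _ [x [y [xy0 ->]]].
  have s0 := sqr_sum_gt0 xy0.
  apply: descend_continuous => //; first by rewrite vec_neq0 orbA xy0.
  have dc : {for vec x y (phi x y),
      continuous (fun v => (v 0 0 * v 0 0 + v 0 1 * v 0 1)^-1)}.
    rewrite /prop_for /continuous_at; apply: (cvgV (F := nbhs _)); last by prove_cvg.
    by rewrite !vecE -!expr2 gt_eqF.
  by rewrite /double; prove_cvg.
- apply/seteqP; split=> [_ [q qC <-]|_ [x [y [xy0 ->]]]].
    rewrite /h; case: ifPn => [/eqP q1|q1].
      by exists q.2, (1 - q.1); split=> //; rewrite subN1_neq0// orbT.
    by exists (1 + q.1), q.2; rewrite [in _ != 0]addrC addr_eq0 q1.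
  have s0 := sqr_sum_gt0 xy0.
  have s1 : x * x + y * y != 0 by rewrite -!expr2 gt_eqF.
  exists (double (vec x y (phi x y))).
    rewrite /unit_circle/= !vecE; field; exact: s1.
  rewrite /h /= !vecE.
  have [x0|x0] := eqVneq x 0.
    move: xy0; rewrite x0 eqxx/= => y0.
    have yE : (0 * 0 - y * y) / (0 * 0 + y * y) = -1 by field.
    rewrite yE eqxx /u2/= !vecE yE -/(pt (0, y)) -(@ptZ (2 / y) (0, y)) ?y0 ?orbT//=.
      by congr (pt (_, _)); field.
    by rewrite mulf_neq0 ?invr_eq0.
  have -> : (x * x - y * y) / (x * x + y * y) == - 1 = false.
    apply/negbTE; rewrite -subr_eq0.
    have -> : (x * x - y * y) / (x * x + y * y) - - 1 =
      2 * x ^+ 2 / (x * x + y * y) by field.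
    by rewrite !mulf_neq0 ?expf_neq0 ?invr_eq0 ?pnatr_eq0.
  rewrite -/(pt (x, y)) -(@ptZ (2 * x / (x * x + y * y)) (x, y)) ?x0//=.
    by rewrite /u1/= !vecE; congr (pt (_, _)); field.
  by rewrite !mulf_neq0 ?invr_eq0 ?pnatr_eq0.
- move=> q /set_mem qC; rewrite /h.
  have qE := unit_circle_sqr qC.
  case: ifPn => [/eqP q1|q1].
    rewrite descendE//; last by rewrite vec_neq0 subN1_neq0// !orbT.
    have q2 : q.2 = 0.
      by apply/eqP; rewrite -sqrf_eq0 qE q1 addrN mul0r.
    rewrite /double /= !vecE q2 q1 [RHS]surjective_pairing q1 q2.
    by congr (_, _); field.
  have a0 : 1 + q.1 != 0 by rewrite addrC addr_eq0.
  rewrite descendE//; last by rewrite vec_neq0 a0.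
  have e : (1 + q.1) * (1 + q.1) + q.2 * q.2 = 2 * (1 + q.1) by rewrite -(expr2 q.2) qE; ring.
  rewrite /double /= !vecE [RHS]surjective_pairing e -!expr2 qE.
  by congr (_, _); field.
Qed.

(** Off the graph of [phi] the plane is star-shaped about [0 : 0 : 1]: up to
    sign a point lies above the graph, and so does the segment that joins it to
    (0, 0, 1). *)
Let connected_compl : connected (~` graph phi).
Proof.
pose above v := (v 0 0 != 0) || (v 0 1 != 0) /\ phi (v 0 0) (v 0 1) < v 0 2%R.
pose I v := v = vec 0 0 1 \/ above v.
pose path v (s : R) := vec (s * v 0 0) (s * v 0 1) (s * v 0 2%R + (1 - s)).
have path_compl v s : I v -> 0 <= s <= 1 ->
    path v s != 0 /\ ~ graph phi (point (path v s)).
  move=> + /andP[]; rewrite le_eqVlt => Iv /predU1P[<- _|s0 s1].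
    have e : path v 0 = vec 0 0 1.
      by rewrite /path !mul0r add0r subr0.
    have nz : vec 0 0 1 != 0 :> 'rV[R]_3 by rewrite vec_neq0 oner_eq0 !orbT.
    by rewrite e; split=> // /(in_odd_graph nz); rewrite eqxx => -[].
  case: Iv => [->|[xy above_v]].
    have -> : path (vec 0 0 1) s = vec 0 0 1.
      by rewrite /path !vecE !mulr0 mulr1 addrC subrK.
    have nz : vec 0 0 1 != 0 :> 'rV[R]_3 by rewrite vec_neq0 oner_eq0 !orbT.
    by split=> // /(in_odd_graph nz); rewrite eqxx => -[].
  have sxy : (s * v 0 0 != 0) || (s * v 0 1 != 0).
    by rewrite !mulf_eq0 !(negbTE (lt0r_neq0 s0)).
  have nz : path v s != 0 by rewrite vec_neq0 orbA sxy.
  split=> // /(in_odd_graph nz)[_]; rewrite phiZ ?(lt0r_neq0 s0)// => e.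
  have : 0 < s * (v 0 2%R - phi (v 0 0) (v 0 1)) by rewrite mulr_gt0 ?subr_gt0.
  by rewrite mulrBr -e; lra.
have -> : ~` graph phi =
    \bigcup_(v in I) ((fun s => point (path v s)) @` `[0, 1]).
  apply/seteqP; split=> [P|P [v Iv [s /= s01 <-]]]; last first.
    by apply: (path_compl v s Iv _).2; move: s01; rewrite in_itv.
  have reach v : I v -> (\bigcup_(v in I) ((fun s => point (path v s)) @` `[0, 1]))
      (point v).
    move=> Iv; exists v => //; exists 1; first by rewrite /= in_itv/= lexx ler01.
    by rewrite /path !mul1r subrr addr0 -vec_eta.
  have [v v0 ->] := pointP P; move: v0.
  rewrite (vec_eta v); move: (v 0 0) (v 0 1) (v 0 2%R) => x y z v0 Pgr.
  have [/andP[/eqP x0 /eqP y0]|xy] := boolP ((x == 0) && (y == 0)).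
    move: v0; rewrite x0 y0 vec_neq0 eqxx/= => z0.
    have -> : vec 0 0 z = z *: vec 0 0 1 by rewrite vecZ !mulr0 mulr1.
    rewrite pointZ//; first by apply: reach; left.
    by rewrite vec_neq0 oner_eq0 !orbT.
  rewrite negb_and in xy.
  have [z_lt|z_gt|z_eq] := ltgtP z (phi x y).
  - rewrite -(@pointZ _ (-1))// ?oppr_eq0 ?oner_eq0//; apply: reach; right.
    rewrite vecZ; split; rewrite !vecE; last by rewrite phiZ ?oppr_eq0 ?oner_eq0//; lra.
    by rewrite !mulN1r !oppr_eq0.
  - by apply: reach; right; split; rewrite !vecE.
  - by case: Pgr; apply/in_odd_graph.
apply: bigcup_connected.
  exists (point (vec 0 0 1)) => v Iv; exists 0; first by rewrite /= in_itv/= lexx ler01.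
  by rewrite /path !mul0r add0r subr0.
move=> v Iv; apply: connected_continuous_connected; first exact: segment_connected.
apply: within_continuous_at => s; rewrite /= in_itv/= => s01.
apply: (point_cvg (F := nbhs s)); first exact: (path_compl v s Iv s01).1.
by rewrite /path; prove_cvg.
Qed.

(** Directions up to sign form a circle, and each of them carries exactly one
    point of the graph. *)
Lemma pseudo_line_graph : pseudo_line (graph phi).
Proof. by split. Qed.

End PseudoLine.

Section Oval.
Variable phi : R -> R -> R.
Hypothesis phiZ : forall k x y, 0 < k -> phi (k * x) (k * y) = k * phi x y.
Hypothesis phi_continuous : continuous (fun q : R * R => phi q.1 q.2).
Hypothesis phi_sum_gt0 : forall x y, (x != 0) || (y != 0) ->
  0 < phi x y + phi (- x) (- y).

Let phiZN k x y : k < 0 -> phi (k * x) (k * y) = - k * phi (- x) (- y).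
Proof. by move=> k0; rewrite -phiZ ?oppr_gt0// !mulrNN. Qed.

Let phi0 : phi 0 0 = 0.
Proof. by have := @phiZ 2 0 0 (ltr0n _ 2); rewrite !mulr0; lra. Qed.

Lemma in_graph x y z : vec x y z != 0 ->
  graph phi (point (vec x y z)) <->
  (x != 0) || (y != 0) /\ (z = phi x y \/ z = - phi (- x) (- y)).
Proof.
move=> v0; split=> [[x' [y' [xy0]]]|[xy0 [->|->]]]; last 2 first.
- by exists x, y.
- exists (- x), (- y); split; first by rewrite !oppr_eq0.
  have nz : vec x y (- phi (- x) (- y)) != 0 by rewrite vec_neq0 orbA xy0.
  by rewrite -(@pointZ _ (-1)) ?oppr_eq0 ?oner_eq0// vecZ !mulN1r opprK.
move=> /(eq_pointP v0); rewrite vec_neq0 orbA xy0 => /(_ isT)[k k0].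
rewrite vecZ => /vec_inj[xE yE zE].
split; first by move: xy0; rewrite xE yE !mulf_eq0 !(negbTE k0).
move: zE; rewrite xE yE; have [kN|kP|/eqP] := ltgtP k 0; last by rewrite (negbTE k0).
- by rewrite phiZN// mulNr => zE; right; apply: (mulfI k0); rewrite mulrN.
- by rewrite phiZ// => zE; left; apply: (mulfI k0).
Qed.

Let mid x y := (phi x y - phi (- x) (- y)) / 2.

Let midZ k x y : k != 0 -> mid (k * x) (k * y) = k * mid x y.
Proof.
rewrite neq_lt /mid => /orP[k0|k0].
  have -> : phi (- (k * x)) (- (k * y)) = - k * phi x y.
    by rewrite -!mulNr phiZ ?oppr_gt0.
  by rewrite phiZN//; field.
by rewrite -!mulrN !phiZ//; field.
Qed.

Let mid_continuous : continuous (fun q : R * R => mid q.1 q.2).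
Proof.
move=> q; rewrite /mid.
have c1 := @phi_continuous q.
have c2 : {for q, continuous (fun q : R * R => phi (- q.1) (- q.2))}.
  have oc : {for q, continuous (fun q : R * R => (- q.1, - q.2))} by prove_cvg.
  exact: (continuous_comp (g := fun q => phi q.1 q.2) oc (@phi_continuous _)).
by prove_cvg.
Qed.

(* On the oval, the height above [mid] selects one of the two unit vectors of a
   line through the origin. *)
Let height v := v 0 2%R - mid (v 0 0) (v 0 1).
Let scale v := `|height v| * Num.sqrt (v 0 0 * v 0 0 + v 0 1 * v 0 1).
Let direction v : R * R :=
  (height v * v 0 0 * (scale v)^-1, height v * v 0 1 * (scale v)^-1).

Let heightZ k v : k != 0 -> height (k *: v) = k * height v.
Proof. by move=> k0; rewrite /height !mxE midZ// mulrBr. Qed.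

Let scaleZ k v : k != 0 -> scale (k *: v) = k ^+ 2 * scale v.
Proof.
move=> k0; rewrite /scale heightZ// !mxE.
have -> : k * v 0 0 * (k * v 0 0) + k * v 0 1 * (k * v 0 1) =
  k ^+ 2 * (v 0 0 * v 0 0 + v 0 1 * v 0 1) by ring.
by rewrite sqrtrM ?sqr_ge0// sqrtr_sqr normrM -(real_normK (num_real k)); ring.
Qed.

Let directionZ k v : k != 0 -> v != 0 -> direction (k *: v) = direction v.
Proof.
move=> k0 _; rewrite /direction heightZ// scaleZ// !mxE.
have [->|s0] := eqVneq (scale v) 0; first by rewrite mulr0 invr0 !mulr0.
by congr (_, _); field; rewrite ?k0 ?s0.
Qed.

Let coord_cont i (v : 'rV[R]_3) : {for v, continuous (fun v : 'rV[R]_3 => v 0 i)}.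
Proof. by prove_cvg. Qed.

Let phi_vec_continuous (f : R -> R -> R) v :
  continuous (fun q : R * R => f q.1 q.2) ->
  {for v, continuous (fun v : 'rV[R]_3 => f (v 0 0) (v 0 1))}.
Proof.
move=> fc.
have oc : {for v, continuous (fun v : 'rV[R]_3 => (v 0 0, v 0 1))} by prove_cvg.
exact: (continuous_comp (g := fun q => f q.1 q.2) oc (@fc _)).
Qed.

Let height_continuous : continuous height.
Proof.
move=> v; have c := @phi_vec_continuous _ v mid_continuous; rewrite /height.
by prove_cvg; exact: c.
Qed.

Let direction_continuous v : scale v != 0 -> {for v, continuous direction}.
Proof.
move=> s0; have hc := @height_continuous v.
have nc : {for v, continuous (fun v => `|height v|)}.
  exact: cvg_norm hc.
have qc : {for v, continuous (fun v => v 0 0 * v 0 0 + v 0 1 * v 0 1)} by prove_cvg.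
have rc : {for v, continuous (fun v => Num.sqrt (v 0 0 * v 0 0 + v 0 1 * v 0 1))}.
  exact: (cvg_comp _ _ qc (@sqrt_continuous R _)).
have sc : {for v, continuous scale} by rewrite /scale; prove_cvg.
have ic : {for v, continuous (fun v => (scale v)^-1)}.
  by rewrite /prop_for /continuous_at; apply: (cvgV (F := nbhs _)).
by rewrite /direction; prove_cvg.
Qed.

Let heightE x y : height (vec x y (phi x y)) = (phi x y + phi (- x) (- y)) / 2.
Proof. by rewrite /height /mid !vecE; field. Qed.

Let height_gt0 x y : (x != 0) || (y != 0) -> 0 < height (vec x y (phi x y)).
Proof. by move=> xy0; rewrite heightE divr_gt0// phi_sum_gt0. Qed.

Let scaleE x y : (x != 0) || (y != 0) -> scale (vec x y (phi x y)) =
  height (vec x y (phi x y)) * Num.sqrt (x ^+ 2 + y ^+ 2).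
Proof. by move=> xy0; rewrite /scale !vecE gtr0_norm ?height_gt0 -?expr2. Qed.

(** The points of the graph over opposite directions are distinct, since [phi]
    exceeds its antipode; hence the unit vector (x, y) is determined by the
    projective point. *)
Lemma embedded_circle_graph : embedded_circle R (graph phi).
Proof.
exists (fun q => point (vec q.1 q.2 (phi q.1 q.2))), (descend direction); split.
- apply: within_continuous_at => q qC.
  apply: graph_point_continuous; last exact: phi_continuous.
  rewrite -negb_and; apply/negP => /andP[/eqP q1 /eqP q2].
  move: qC; rewrite /unit_circle/= q1 q2 expr0n addr0 => /esym/eqP.
  by rewrite oner_eq0.
- apply: within_continuous_at => _ [x [y [xy0 ->]]].
  have s0 := sqr_sum_gt0 xy0.
  apply: descend_continuous => //; first by rewrite vec_neq0 orbA xy0.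
  apply: direction_continuous.
  by rewrite scaleE// mulf_neq0 ?gt_eqF ?height_gt0 ?sqrtr_gt0.
- apply/seteqP; split=> [_ [q qC <-]|_ [x [y [xy0 ->]]]].
    exists q.1, q.2; split=> //.
    rewrite -negb_and; apply/negP => /andP[/eqP q1 /eqP q2].
    move: qC; rewrite /unit_circle/= q1 q2 expr0n addr0 => /esym/eqP.
    by rewrite oner_eq0.
  have s0 := sqr_sum_gt0 xy0; set r := Num.sqrt (x ^+ 2 + y ^+ 2).
  have r0 : 0 < r by rewrite sqrtr_gt0.
  have rE : r ^+ 2 = x ^+ 2 + y ^+ 2 by rewrite sqr_sqrtr// ltW.
  exists (r^-1 * x, r^-1 * y).
    rewrite /unit_circle/= !exprMn -mulrDr -rE -exprMn mulVf ?expr1n//.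
    by rewrite gt_eqF.
  rewrite /= phiZ ?invr_gt0// -vecZ pointZ ?invr_eq0 ?gt_eqF//.
  by rewrite vec_neq0 orbA xy0.
- move=> q /set_mem qC.
  have q0 : (q.1 != 0) || (q.2 != 0).
    rewrite -negb_and; apply/negP => /andP[/eqP q1 /eqP q2].
    move: qC; rewrite /unit_circle/= q1 q2 expr0n addr0 => /esym/eqP.
    by rewrite oner_eq0.
  rewrite descendE//; last by rewrite vec_neq0 orbA q0.
  rewrite /direction scaleE// qC sqrtr1 mulr1 !vecE.
  have h0 := height_gt0 q0.
  rewrite [RHS]surjective_pairing; congr (_, _).
    by rewrite mulrAC mulfV ?mul1r// gt_eqF.
  by rewrite mulrAC mulfV ?mul1r// gt_eqF.
Qed.

(** The complement is split by the open sets of points above the graph and of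
    points strictly between the graph and its antipode; the former contains
    [0 : 0 : 1]. *)
Lemma disconnected_compl_graph : ~ connected (~` graph phi).
Proof.
pose f v := phi (v 0 0) (v 0 1).
pose fN v := - phi (- v 0 0) (- v 0 1).
have fc : continuous f by move=> v; exact: phi_vec_continuous.
have fNc : continuous fN.
  move=> v; apply: (@phi_vec_continuous (fun x y => - phi (- x) (- y))) => q.
  have oc : {for q, continuous (fun q : R * R => (- q.1, - q.2))} by prove_cvg.
  have c2 : {for q, continuous (fun q : R * R => phi (- q.1) (- q.2))}.
    exact: (continuous_comp (g := fun q => phi q.1 q.2) oc (@phi_continuous _)).
  by prove_cvg.
pose W1 := [set v : 'rV[R]_3 | f v < v 0 2%R].
pose W2 := [set v : 'rV[R]_3 | fN v < v 0 2%R] `&` [set v : 'rV[R]_3 | v 0 2%R < f v].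
have oW1 : open W1.
  by apply: open_lt_fun => v; [exact: fc|exact: coord_cont].
have oW2 : open W2.
  apply: openI; apply: open_lt_fun => v.
  - exact: fNc.
  - exact: coord_cont.
  - exact: coord_cont.
  - exact: fc.
pose U W := point @` (W `&` [set v : 'rV[R]_3 | v != 0]).
have U12 : U W1 `&` U W2 = set0.
  apply/seteqP; split=> // _ [[v [v1 v0] <-] [w [[wN wP] w0]]].
  move=> /esym/(eq_pointP v0 w0)[k k0 wE]; move: v1 wN wP; rewrite /W1 /f /fN/= wE !mxE.
  have [kN|kP|/eqP] := ltgtP k 0; last by rewrite (negbTE k0).
    move=> vf; rewrite -!mulNr (@phiZ (- k)) ?oppr_gt0// mulNr opprK ltr_nM2l//.
    by rewrite ltNge (ltW vf).
  by move=> vf _; rewrite phiZ// ltr_pM2l// ltNge (ltW vf).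
have U12E : ~` graph phi = U W1 `|` U W2.
  apply/seteqP; split=> [P Pgr|P]; last first.
    case=> -[v [vW v0] <-]; move: v0 vW; rewrite (vec_eta v);
      move: (v 0 0) (v 0 1) (v 0 2%R) => x y z v0; rewrite /W1 /W2 /f /fN /= !vecE.
      move=> zP /(in_graph v0)[xy []]; first by move=> zE; rewrite zE ltxx in zP.
      by have := phi_sum_gt0 xy; lra.
    by move=> [zN zP] /(in_graph v0)[xy [] zE]; rewrite zE ltxx in zP zN.
  have [v v0 PE] := pointP P; rewrite {}PE in Pgr *; move: v0 Pgr.
  rewrite (vec_eta v); move: (v 0 0) (v 0 1) (v 0 2%R) => x y z v0 Pgr.
  have [xy|] := boolP ((x != 0) || (y != 0)).
    have nz : - 1 *: vec x y z != 0 by rewrite scaler_eq0 negb_or oppr_eq0 oner_eq0.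
    have [zP|zP|zE] := ltgtP z (phi x y); last by case: Pgr; apply/in_graph; auto.
    - have [zN|zN|zE] := ltgtP z (- phi (- x) (- y)); last by case: Pgr; apply/in_graph; auto.
      + left; exists (- 1 *: vec x y z); last by rewrite pointZ ?oppr_eq0 ?oner_eq0.
        by split=> //; rewrite /W1 /f /= vecZ !vecE !mulN1r; lra.
      + by right; exists (vec x y z) => //; split=> //; rewrite /W2 /f /fN/= !vecE.
    - by left; exists (vec x y z) => //; split=> //; rewrite /W1 /f /= !vecE.
  rewrite negb_or !negbK => /andP[/eqP x0 /eqP y0].
  move: v0; rewrite x0 y0 vec_neq0 eqxx/= => z0.
  have e : vec 0 0 z = z *: vec 0 0 1 by rewrite vecZ !mulr0 mulr1.
  left; exists (vec 0 0 1); last by rewrite e pointZ// vec_neq0 oner_eq0 !orbT.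
  by split; rewrite /W1 /f /= ?vecE ?phi0 ?ltr01// vec_neq0 oner_eq0 !orbT.
have U2 : U W2 !=set0.
  exists (point (vec 1 0 (mid 1 0))), (vec 1 0 (mid 1 0)) => //.
  split; last by rewrite /= vec_neq0 oner_eq0.
  have : (1 != 0 :> R) || (0 != 0 :> R) by rewrite oner_eq0.
  move=> /phi_sum_gt0; rewrite /W2 /f /fN /mid /= !vecE => h.
  by split; rewrite ?ltr_pdivlMr ?ltr_pdivrMr//; lra.
move=> /(_ (U W1)) h.
have : U W1 = ~` graph phi.
  apply: h.
  - exists (point (vec 0 0 1)), (vec 0 0 1) => //; split=> //.
      by rewrite /W1 /f /= !vecE phi0 ltr01.
    by rewrite /= vec_neq0 oner_eq0 !orbT.
  - exists (U W1); first exact: open_point.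
    by rewrite U12E; apply/seteqP; split=> P; [split=> //; left|case].
  - exists (~` U W2); first by apply: open_closedC; exact: open_point.
    rewrite U12E; apply/seteqP; split=> P; last by case=> -[].
    move=> P1; split; first by left.
    by move=> P2; have : (U W1 `&` U W2) P by []; rewrite U12.
rewrite U12E; case: U2 => P P2 E.
have : (U W1 `&` U W2) P by split=> //; rewrite E; right.
by rewrite U12.
Qed.

Lemma oval_graph : oval (graph phi).
Proof.
by split; [exact: embedded_circle_graph|exact: disconnected_compl_graph].
Qed.

End Oval.

End Graphs.

(** * Ternary cubics in coordinates *)

Section Cubics.
Context (R : realType).
Implicit Types (a : 'rV[R]_10) (x y z : R).

Definition coef a k : R := a 0 (inord k).

Definition cubic a x y z : R :=
  coef a 0 * (x * x * x) + coef a 1 * (x * x * y) + coef a 2 * (x * x * z)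
  + coef a 3 * (x * y * y) + coef a 4 * (x * y * z) + coef a 5 * (x * z * z)
  + coef a 6 * (y * y * y) + coef a 7 * (y * y * z) + coef a 8 * (y * z * z)
  + coef a 9 * (z * z * z).

Definition cubic_x a x y z : R :=
  3 * coef a 0 * (x * x) + 2 * coef a 1 * (x * y) + 2 * coef a 2 * (x * z)
  + coef a 3 * (y * y) + coef a 4 * (y * z) + coef a 5 * (z * z).

Definition cubic_y a x y z : R :=
  coef a 1 * (x * x) + 2 * coef a 3 * (x * y) + coef a 4 * (x * z)
  + 3 * coef a 6 * (y * y) + 2 * coef a 7 * (y * z) + coef a 8 * (z * z).

Definition cubic_z a x y z : R :=
  coef a 2 * (x * x) + coef a 4 * (x * y) + 2 * coef a 5 * (x * z)
  + coef a 7 * (y * y) + 2 * coef a 8 * (y * z) + 3 * coef a 9 * (z * z).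

Definition monomials : seq (multinom 3) :=
  [:: exponent 3 0 0; exponent 2 1 0; exponent 2 0 1; exponent 1 2 0;
      exponent 1 1 1; exponent 1 0 2; exponent 0 3 0; exponent 0 2 1;
      exponent 0 1 2; exponent 0 0 3]%N.

Definition monomial (i : 'I_10) : multinom 3 := nth (exponent 0 0 0) monomials i.

Definition cubic_mpoly a : mpoly 3 R :=
  \sum_(i < 10) a 0 i *: mpolyX R (monomial i).

Lemma cubic_mpoly_homog a : cubic_mpoly a \is ishomog1 3 mdeg.
Proof.
apply: rpred_sum => i _; apply: rpredZ; rewrite dhomogX /= mdegE.
by case: i => -[|[|[|[|[|[|[|[|[|[|//]]]]]]]]]] ?; rewrite !big_ord_recl big_ord0.
Qed.

Definition cubic_of a : ternary_cubic R := DHomog (cubic_mpoly_homog a).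

Lemma sum10 (V : nmodType) (F : 'I_10 -> V) :
  \sum_(i < 10) F i = F (inord 0) + F (inord 1) + F (inord 2) + F (inord 3)
    + F (inord 4) + F (inord 5) + F (inord 6) + F (inord 7) + F (inord 8)
    + F (inord 9).
Proof.
rewrite !big_ord_recr big_ord0 /= add0r.
by do 9 ?congr (_ + _); congr F; apply: val_inj; rewrite /= inordK.
Qed.

Lemma monomial_inord k : (k < 10)%N -> monomial (inord k) = nth (exponent 0 0 0) monomials k.
Proof. by move=> k10; rewrite /monomial inordK. Qed.

Lemma coefficients_cubic_of a (t : 10.-tuple R) :
  (forall i, a 0 i = tnth t i) -> coefficients (cubic_of a) = t.
Proof.
move=> at_.
have mc i : mcoeff (monomial i) (cubic_mpoly a) = tnth t i.
  rewrite /cubic_mpoly linear_sum (bigD1 i)//= mcoeffZ mcoeffX eqxx mulr1 at_.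
  rewrite big1 ?addr0// => j ji; rewrite mcoeffZ mcoeffX.
  suff -> : (monomial j == monomial i) = false by rewrite mulr0.
  apply/negbTE; apply: contra ji; rewrite /monomial nth_uniq//.
apply: eq_from_tnth => i; rewrite -mc (tnth_nth 0).
by case: i => -[|[|[|[|[|[|[|[|[|[|//]]]]]]]]]] ?.
Qed.

Lemma meval_exponent (v : 'rV[R]_3) i j k :
  meval (v 0) (mpolyX R (exponent i j k)) =
  v 0 0 ^+ i * v 0 1 ^+ j * v 0 2%R ^+ k.
Proof.
rewrite mevalX !big_ord_recl big_ord0 mulr1 !mulrA.
by congr (v 0 _ ^+ _ * v 0 _ ^+ _ * v 0 _ ^+ _); exact: val_inj.
Qed.

Lemma mderiv_exponent (v : 'rV[R]_3) i j k :
  (meval (v 0) (mderiv 0 (mpolyX R (exponent i j k))) =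
     i%:R * (v 0 0 ^+ i.-1 * v 0 1 ^+ j * v 0 2%R ^+ k)) *
  (meval (v 0) (mderiv 1 (mpolyX R (exponent i j k))) =
     j%:R * (v 0 0 ^+ i * v 0 1 ^+ j.-1 * v 0 2%R ^+ k)) *
  (meval (v 0) (mderiv 2%R (mpolyX R (exponent i j k))) =
     k%:R * (v 0 0 ^+ i * v 0 1 ^+ j * v 0 2%R ^+ k.-1)).
Proof.
rewrite !mderivX !mevalZ -!meval_exponent.
by do 2?split; congr (_ * meval _ (mpolyX R _)); apply/mnmP;
  case=> -[|[|[|//]]] ?; rewrite mnmBE mnm1E /= ?subn1 ?subn0.
Qed.

Lemma meval_cubic_of a (v : 'rV[R]_3) :
  meval (v 0) (cubic_of a : mpoly 3 R) = cubic a (v 0 0) (v 0 1) (v 0 2%R).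
Proof.
rewrite /= /cubic_mpoly (linear_sum (meval (v 0))) sum10 /= !mevalZ !monomial_inord//=.
by rewrite !meval_exponent /cubic /coef; ring.
Qed.

Lemma gradient_cubic_of a (v : 'rV[R]_3) : gradient (cubic_of a) v =
  vec (cubic_x a (v 0 0) (v 0 1) (v 0 2%R)) (cubic_y a (v 0 0) (v 0 1) (v 0 2%R))
    (cubic_z a (v 0 0) (v 0 1) (v 0 2%R)).
Proof.
have E i : gradient (cubic_of a) v 0 i =
    \sum_(k < 10) a 0 k * meval (v 0) (mderiv i (mpolyX R (monomial k))).
  rewrite mxE /= /cubic_mpoly (linear_sum (mderiv i)) (linear_sum (meval (v 0))) /=.
  by apply: eq_bigr => k _; rewrite mderivZ mevalZ.
rewrite [LHS]vec_eta !E !sum10 !monomial_inord//= !mderiv_exponent.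
by rewrite /cubic_x /cubic_y /cubic_z /coef; congr vec; ring.
Qed.

End Cubics.

(** * Real points of cubics *)

Section Roots.
Context (R : realType).

(** Roots depend continuously on parameters because the position of a number
    relative to a root is a sign condition; this is the form in which it is
    used. *)
Lemma continuous_of_lt_gt (T : topologicalType) (psi : T -> R) p :
  (forall s, s < psi p -> \forall q \near p, s < psi q) ->
  (forall s, psi p < s -> \forall q \near p, psi q < s) ->
  {for p, continuous psi}.
Proof.
move=> lo hi; apply/cvgrPdist_lt => e e0.
have lo_e : \forall q \near p, psi p - e < psi q by apply: lo; lra.
have hi_e : \forall q \near p, psi q < psi p + e by apply: hi; lra.
by apply: filterS2 lo_e hi_e => q h1 h2; rewrite ltr_norml; lra.
Qed.

Lemma sign_change_root (g : R -> R) l r : l < r -> continuous g ->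
  g l * g r < 0 -> exists2 s, l < s < r & g s = 0.
Proof.
move=> lr gc glr.
have [] := @IVT R g l r 0 (ltW lr).
- exact: continuous_subspaceT.
- rewrite ge_min le_max.
  have [l0|l0|l0] := ltgtP (g l) 0; last by rewrite l0 mul0r ltxx in glr.
    have r0 : 0 < g r by rewrite -(nmulr_rlt0 _ l0).
    by rewrite /= (ltW r0).
  have r0 : g r < 0 by rewrite -(pmulr_rlt0 _ l0).
  by rewrite /= (ltW r0).
- move=> s; rewrite in_itv/= => /andP[ls sr] gs; exists s => //.
  rewrite !lt_neqAle ls sr !andbT; apply/andP; split; apply/eqP => e.
    by rewrite e gs mul0r ltxx in glr.
  by rewrite -e gs mulr0 ltxx in glr.
Qed.

(** The difference of the two sides is a quadratic polynomial with three
    distinct roots. *)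
Lemma cubic_factor (d e g k r1 r2 r3 : R) (p : R -> R) :
  (forall s, p s = d * (s * s * s) + e * (s * s) + g * s + k) ->
  r1 < r2 < r3 -> p r1 = 0 -> p r2 = 0 -> p r3 = 0 ->
  forall s, p s = d * ((s - r1) * (s - r2) * (s - r3)).
Proof.
move=> pE /andP[r12 r23] p1 p2 p3 s.
pose e' := e + d * (r1 + r2 + r3).
pose g' := g - d * (r1 * r2 + r1 * r3 + r2 * r3).
pose k' := k + d * (r1 * r2 * r3).
have qE u : p u - d * ((u - r1) * (u - r2) * (u - r3)) = e' * (u * u) + g' * u + k'.
  by rewrite pE /e' /g' /k'; ring.
have q1 : e' * (r1 * r1) + g' * r1 + k' = 0 by rewrite -qE p1; ring.
have q2 : e' * (r2 * r2) + g' * r2 + k' = 0 by rewrite -qE p2; ring.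
have q3 : e' * (r3 * r3) + g' * r3 + k' = 0 by rewrite -qE p3; ring.
have l12 : e' * (r1 + r2) + g' = 0.
  have d0 : r1 - r2 != 0 by rewrite subr_eq0 lt_eqF.
  by apply: (mulfI d0); rewrite mulr0; lra.
have l23 : e' * (r2 + r3) + g' = 0.
  have d0 : r2 - r3 != 0 by rewrite subr_eq0 lt_eqF.
  by apply: (mulfI d0); rewrite mulr0; lra.
have e0 : e' = 0.
  have d0 : r1 - r3 != 0 by rewrite subr_eq0 lt_eqF// (lt_trans r12).
  by apply: (mulfI d0); rewrite mulr0; lra.
have g0 : g' = 0 by rewrite e0 in l12; lra.
have k0 : k' = 0 by rewrite e0 g0 in q1; lra.
by apply/eqP; rewrite -subr_eq0 qE e0 g0 k0; apply/eqP; ring.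
Qed.

End Roots.

Section OvalsOfCubics.
Context (R : realType).
Implicit Types (a : 'rV[R]_10) (x y z k s : R).

Lemma cubicZ a k x y z :
  cubic a (k * x) (k * y) (k * z) = k ^+ 3 * cubic a x y z.
Proof. by rewrite /cubic; ring. Qed.

Lemma zero_locusP a (P : projective_plane R) :
  zero_locus (cubic_of a) P <-> exists x y z,
    [/\ vec x y z != 0, P = point (vec x y z) & cubic a x y z = 0].
Proof.
split=> [[v /= fv <-]|[x [y [z [v0 -> fv]]]]].
  exists (val v 0 0), (val v 0 1), (val v 0 2%R); rewrite -vec_eta nonzero_val.
  by rewrite -proj_pointE -meval_cubic_of.
exists (insubd (default_vector R) (vec x y z)) => //=.
by rewrite meval_cubic_of (val_insubd_neq0 v0) !vecE.
Qed.

Lemma cubic_of_neq0 a : coef a 9 != 0 -> cubic_of a != 0.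
Proof.
apply: contraNneq => a0; have := meval_cubic_of a (vec 0 0 1).
by rewrite a0 /= meval0 /cubic !vecE => e; apply/eqP; lra.
Qed.

Lemma cubic_continuous (T : topologicalType) (F : T -> 'rV[R]_10) (x y z : T -> R) p :
  {for p, continuous F} -> {for p, continuous x} -> {for p, continuous y} ->
  {for p, continuous z} ->
  {for p, continuous (fun q => cubic (F q) (x q) (y q) (z q))}.
Proof. by move=> Fc xc yc zc; rewrite /cubic /coef; prove_cvg. Qed.

Section NoOval.
Variable a : 'rV[R]_10.
Hypothesis cubic_z_gt0 : forall x y z, vec x y z != 0 -> 0 < cubic_z a x y z.

Let lead_gt0 : 0 < coef a 9.
Proof.
have : 0 < cubic_z a 0 0 1 by apply: cubic_z_gt0; rewrite vec_neq0 oner_eq0 !orbT.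
by rewrite /cubic_z; lra.
Qed.

Let cubic_z_ge0 x y z : 0 <= cubic_z a x y z.
Proof.
have [v0|/cubic_z_gt0/ltW//] := eqVneq (vec x y z) 0.
by move: v0; rewrite -vec0 => /vec_inj[-> -> ->]; rewrite /cubic_z; lra.
Qed.

(* The difference quotient of a cubic polynomial is its derivative at the
   midpoint plus a quarter of the leading coefficient times the square of the
   length. *)
Let cubicB x y s r : cubic a x y s - cubic a x y r =
  (s - r) * (cubic_z a x y ((s + r) / 2) + coef a 9 * (s - r) ^+ 2 / 4).
Proof. by rewrite /cubic /cubic_z; field. Qed.

Let cubic_lt x y s r : s < r -> cubic a x y s < cubic a x y r.
Proof.
move=> sr; rewrite -subr_gt0 cubicB mulr_gt0 ?subr_gt0//.
rewrite ltr_wpDl// divr_gt0// mulr_gt0// exprn_even_gt0//= subr_eq0.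
by rewrite gt_eqF.
Qed.

Let root_exists x y : exists s, cubic a x y s = 0.
Proof.
have d0 : 0 < coef a 9 := lead_gt0.
(* By [cubicB], cubic a x y S - c is at least coef a 9 * S ^+ 3 / 4. *)
pose c := cubic a x y 0; pose S := 1 + 4 * `|c| / coef a 9.
have S1 : 1 <= S.
  by rewrite lerDl divr_ge0 ?mulr_ge0// ltW.
have cS : `|c| < coef a 9 * S / 4.
  have -> : coef a 9 * S = coef a 9 + 4 * `|c| by rewrite /S; field; rewrite gt_eqF.
  by lra.
have S2 : S <= S * (S * S).
  by rewrite ler_peMr//; nra.
have hi : 0 < cubic a x y S.
  have := cubicB x y S 0; rewrite -/c subr0 addr0 mulrDr.
  have := mulr_ge0 (ltW (lt_le_trans ltr01 S1)) (cubic_z_ge0 x y (S / 2)).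
  have := ler_norm (- c); rewrite normrN.
  have : coef a 9 * S <= coef a 9 * (S * (S * S)) by rewrite ler_pM2l.
  by lra.
have lo : cubic a x y (- S) < 0.
  have : c - cubic a x y (- S) =
      S * cubic_z a x y (- S / 2) + S * (coef a 9 * S ^+ 2 / 4).
    by rewrite /c /cubic /cubic_z; field.
  have := mulr_ge0 (ltW (lt_le_trans ltr01 S1)) (cubic_z_ge0 x y (- S / 2)).
  have := ler_norm c.
  have : coef a 9 * S <= coef a 9 * (S * (S * S)) by rewrite ler_pM2l.
  by lra.
have [|||s _ ?] := @sign_change_root R (cubic a x y) (- S) S; last by exists s.
- by lra.
- by move=> s; apply: (@cubic_continuous _ (fun=> a) (fun=> x) (fun=> y) id); (exact: cvg_cst || exact: cvg_id).
- by rewrite nmulr_rlt0.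
Qed.

Let root x y := sval (cid (root_exists x y)).
Let rootP x y : cubic a x y (root x y) = 0.
Proof. exact: svalP (cid (root_exists x y)). Qed.

Let root_gt x y s : (s < root x y) = (cubic a x y s < 0).
Proof.
have [h|h|->] := ltgtP s (root x y); last by rewrite rootP ltxx.
  by have := cubic_lt x y h; rewrite rootP => ->.
by have := cubic_lt x y h; rewrite rootP => /ltW; rewrite leNgt => /negbTE.
Qed.

Let root_lt x y s : (root x y < s) = (0 < cubic a x y s).
Proof.
have [h|h|<-] := ltgtP (root x y) s; last by rewrite rootP ltxx.
  by have := cubic_lt x y h; rewrite rootP => ->.
by have := cubic_lt x y h; rewrite rootP => /ltW; rewrite leNgt => /negbTE.
Qed.

Let root_uniq x y s : cubic a x y s = 0 -> s = root x y.
Proof.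
move=> s0; have [h|h|//] := ltgtP s (root x y); move: h.
  by rewrite root_gt s0 ltxx.
by rewrite root_lt s0 ltxx.
Qed.

Let rootZ k x y : root (k * x) (k * y) = k * root x y.
Proof. by apply/esym/root_uniq; rewrite cubicZ rootP mulr0. Qed.

Let slice_continuous s (q : R * R) :
  {for q, continuous (fun q : R * R => cubic a q.1 q.2 s)}.
Proof.
by apply: (@cubic_continuous _ (fun=> a) (fun q : R * R => q.1)
  (fun q => q.2) (fun=> s));
  prove_cvg.
Qed.

Let root_continuous (q : R * R) :
  {for q, continuous (fun q => root q.1 q.2)}.
Proof.
apply: continuous_of_lt_gt => s.
  rewrite root_gt => /(near_lt (@slice_continuous s q)).
  by apply: filterS => p; rewrite root_gt.
rewrite root_lt => /(near_gt (@slice_continuous s q)).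
by apply: filterS => p; rewrite root_lt.
Qed.

(** On every line through [0 : 0 : 1] the cubic increases from minus to plus
    infinity; by uniqueness its root is an odd and continuous function of the
    direction. *)
Theorem has_no_oval : has_ovals 0 (cubic_of a).
Proof.
split; first by rewrite cubic_of_neq0// gt_eqF.
exists (fun=> set0), (graph root); split.
- by case.
- apply: pseudo_line_graph => [k x y _ _|q _]; first exact: rootZ.
  exact: root_continuous.
- by case.
- by case.
- rewrite bigcup0 ?set0U; last by case.
  apply/seteqP; split=> P.
    move=> /zero_locusP[x [y [z [v0 -> fv]]]].
    exists x, y; rewrite -(root_uniq fv); split=> //.
    rewrite -negb_and; apply/negP => /andP[/eqP x0 /eqP y0].
    have z0 : z = 0.
      by rewrite (root_uniq fv) x0 y0; apply/esym/root_uniq; rewrite /cubic; ring.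
    by move: v0; rewrite x0 y0 z0 vec0 eqxx.
  move=> [x [y [xy0 ->]]]; apply/zero_locusP; exists x, y, (root x y).
  by split=> //; rewrite vec_neq0 orbA xy0.
Qed.

End NoOval.

End OvalsOfCubics.

Section OneOval.
Context (R : realType).
Variable a : 'rV[R]_10.
Hypothesis lead_gt0 : 0 < coef a 9.
Hypothesis cubic_at1 : forall x y, x ^+ 2 + y ^+ 2 = 1 -> cubic a x y 1 < 0.
Hypothesis cubic_at4 : forall x y, x ^+ 2 + y ^+ 2 = 1 -> 0 < cubic a x y 4.
Implicit Types (x y z k s : R).

Let n x y := Num.sqrt (x ^+ 2 + y ^+ 2).

Let n_gt0 x y : (x != 0) || (y != 0) -> 0 < n x y.
Proof. by move=> /sqr_sum_gt0; rewrite sqrtr_gt0. Qed.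

Let nZ k x y : n (k * x) (k * y) = `|k| * n x y.
Proof.
by rewrite /n !exprMn -mulrDr sqrtrM ?sqr_ge0// sqrtr_sqr.
Qed.

Let nN x y : n (- x) (- y) = n x y.
Proof. by rewrite /n !sqrrN. Qed.

Let cubicN x y z : cubic a (- x) (- y) (- z) = - cubic a x y z.
Proof. by rewrite /cubic; ring. Qed.

Let unit_n x y : (x != 0) || (y != 0) ->
  ((n x y)^-1 * x) ^+ 2 + ((n x y)^-1 * y) ^+ 2 = 1.
Proof.
move=> xy; have s0 := sqr_sum_gt0 xy.
rewrite !exprMn -mulrDr exprVn sqr_sqrtr ?(ltW s0)// mulVf//.
by rewrite gt_eqF.
Qed.

Let cubic_n x y s : (x != 0) || (y != 0) ->
  cubic a x y (s * n x y) = n x y ^+ 3 * cubic a ((n x y)^-1 * x) ((n x y)^-1 * y) s.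
Proof.
move=> /n_gt0 n0; rewrite -cubicZ; congr cubic; last by rewrite mulrC.
  by rewrite mulVKf// gt_eqF.
by rewrite mulVKf// gt_eqF.
Qed.

Let cubic_at_n x y : (x != 0) || (y != 0) -> cubic a x y (n x y) < 0.
Proof.
move=> xy; rewrite -[n x y]mul1r cubic_n// pmulr_rlt0 ?exprn_gt0 ?n_gt0//.
exact/cubic_at1/unit_n.
Qed.

Let cubic_at_4n x y : (x != 0) || (y != 0) -> 0 < cubic a x y (4 * n x y).
Proof.
move=> xy; rewrite cubic_n// pmulr_rgt0 ?exprn_gt0 ?n_gt0//.
exact/cubic_at4/unit_n.
Qed.

Let cubic_cont x y : continuous (cubic a x y).
Proof.
move=> s; apply: (@cubic_continuous R _ (fun=> a) (fun=> x) (fun=> y) id);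
  (exact: cvg_cst || exact: cvg_id).
Qed.

(* The smallest root is left out, being minus the largest root in the opposite
   direction. The value at the origin makes the largest root continuous. *)
Let two_roots x y : exists r : R * R,
  if (x != 0) || (y != 0) then
    [/\ - n x y < r.1 < n x y, n x y < r.2 < 4 * n x y &
      exists2 r1, r1 < - n x y & forall s, cubic a x y s =
        coef a 9 * ((s - r1) * (s - r.1) * (s - r.2))]
  else r = (0, 0).
Proof.
have [xy|xy] := boolP ((x != 0) || (y != 0)); last by exists (0, 0).
have n0 := n_gt0 xy.
have xyN : (- x != 0) || (- y != 0) by rewrite !oppr_eq0.
have p1 := cubic_at_n xy; have p4 := cubic_at_4n xy.
have m1 : 0 < cubic a x y (- n x y).
  by rewrite -oppr_lt0 -cubicN opprK -nN cubic_at_n.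
have m4 : cubic a x y (- (4 * n x y)) < 0.
  by rewrite -oppr_gt0 -cubicN opprK -nN cubic_at_4n.
have [|||r1 /andP[_ r1n] z1] :=
  @sign_change_root R (cubic a x y) (- (4 * n x y)) (- n x y).
- by lra.
- exact: (@cubic_cont x y).
- by rewrite nmulr_rlt0.
have [|||r2 r2n z2] := @sign_change_root R (cubic a x y) (- n x y) (n x y).
- by lra.
- exact: (@cubic_cont x y).
- by rewrite pmulr_rlt0.
have [|||r3 r3n z3] := @sign_change_root R (cubic a x y) (n x y) (4 * n x y).
- by lra.
- exact: (@cubic_cont x y).
- by rewrite nmulr_rlt0.
exists (r2, r3); split=> //=; exists r1 => //.
apply: (@cubic_factor R _ (coef a 5 * x + coef a 8 * y)
  (coef a 2 * (x * x) + coef a 4 * (x * y) + coef a 7 * (y * y))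
  (coef a 0 * (x * x * x) + coef a 1 * (x * x * y) + coef a 3 * (x * y * y)
    + coef a 6 * (y * y * y))) => //.
  by move=> s; rewrite /cubic; ring.
by move: r2n r3n => /andP[h1 h2] /andP[h3 h4]; apply/andP; split; lra.
Qed.

Let middle x y := (sval (cid (two_roots x y))).1.
Let upper x y := (sval (cid (two_roots x y))).2.

Let rootsP x y : (x != 0) || (y != 0) ->
  [/\ - n x y < middle x y < n x y, n x y < upper x y < 4 * n x y &
    exists2 r1, r1 < - n x y & forall s, cubic a x y s =
      coef a 9 * ((s - r1) * (s - middle x y) * (s - upper x y))].
Proof. by move=> xy; rewrite /middle /upper; case: (cid _) => r /=; rewrite xy. Qed.

Let upper0 : upper 0 0 = 0.
Proof. by rewrite /upper; case: (cid _) => r /=; rewrite eqxx /= => ->. Qed.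

Let upper_gt x y s : (x != 0) || (y != 0) -> n x y < s ->
  (s < upper x y) = (cubic a x y s < 0).
Proof.
move=> xy ns; have [/andP[_ mn] _ [r1 r1n ->]] := rootsP xy.
rewrite pmulr_rlt0// pmulr_rlt0 ?subr_lt0// mulr_gt0// subr_gt0.
  by have := n_gt0 xy; lra.
by lra.
Qed.

Let upper_lt x y s : (x != 0) || (y != 0) -> n x y < s ->
  (upper x y < s) = (0 < cubic a x y s).
Proof.
move=> xy ns; have [/andP[_ mn] _ [r1 r1n ->]] := rootsP xy.
rewrite pmulr_rgt0// pmulr_rgt0 ?subr_gt0// mulr_gt0// subr_gt0.
  by have := n_gt0 xy; lra.
by lra.
Qed.

Let middle_gt x y s : (x != 0) || (y != 0) -> - n x y < s < n x y ->
  (s < middle x y) = (0 < cubic a x y s).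
Proof.
move=> xy /andP[sn ns]; have [_ /andP[nu _] [r1 r1n ->]] := rootsP xy.
rewrite pmulr_rgt0// mulrAC nmulr_rgt0 ?subr_lt0//.
by rewrite nmulr_llt0 ?subr_lt0 ?subr_gt0; lra.
Qed.

Let middle_lt x y s : (x != 0) || (y != 0) -> - n x y < s < n x y ->
  (middle x y < s) = (cubic a x y s < 0).
Proof.
move=> xy /andP[sn ns]; have [_ /andP[nu _] [r1 r1n ->]] := rootsP xy.
rewrite pmulr_rlt0// mulrAC nmulr_rlt0 ?subr_gt0//.
by rewrite nmulr_llt0 ?subr_lt0 ?subr_gt0; lra.
Qed.

Let upper_uniq x y s : (x != 0) || (y != 0) -> n x y < s ->
  cubic a x y s = 0 -> s = upper x y.
Proof.
move=> xy ns s0; have [h|h|//] := ltgtP s (upper x y); move: h.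
  by rewrite upper_gt// s0 ltxx.
by rewrite upper_lt// s0 ltxx.
Qed.

Let middle_uniq x y s : (x != 0) || (y != 0) -> - n x y < s < n x y ->
  cubic a x y s = 0 -> s = middle x y.
Proof.
move=> xy ns s0; have [h|h|//] := ltgtP s (middle x y); move: h.
  by rewrite middle_gt// s0 ltxx.
by rewrite middle_lt// s0 ltxx.
Qed.

Let cubic_upper x y : (x != 0) || (y != 0) -> cubic a x y (upper x y) = 0.
Proof. by move=> /rootsP[_ _ [r1 _ ->]]; rewrite subrr !mulr0. Qed.

Let cubic_middle x y : (x != 0) || (y != 0) -> cubic a x y (middle x y) = 0.
Proof. by move=> /rootsP[_ _ [r1 _ ->]]; rewrite subrr mulr0 mul0r mulr0. Qed.

Let scale_neq0 k x y : k != 0 -> (x != 0) || (y != 0) ->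
  (k * x != 0) || (k * y != 0).
Proof. by move=> k0; rewrite !mulf_eq0 !(negbTE k0). Qed.

Let upperZ k x y : 0 < k -> upper (k * x) (k * y) = k * upper x y.
Proof.
move=> k0; have [xy|] := boolP ((x != 0) || (y != 0)); last first.
  by rewrite negb_or !negbK => /andP[/eqP-> /eqP->]; rewrite !mulr0 upper0 mulr0.
have [_ /andP[nu _] _] := rootsP xy.
apply/esym/upper_uniq; first by rewrite scale_neq0// gt_eqF.
  by rewrite nZ gtr0_norm// ltr_pM2l.
by rewrite cubicZ cubic_upper// mulr0.
Qed.

Let middleZ k x y : k != 0 -> (x != 0) || (y != 0) ->
  middle (k * x) (k * y) = k * middle x y.
Proof.
move=> k0 xy; have [mn _ _] := rootsP xy.
apply/esym/middle_uniq; first by rewrite scale_neq0.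
  by rewrite -ltr_norml nZ normrM ltr_pM2l ?normr_gt0// ltr_norml.
by rewrite cubicZ cubic_middle// mulr0.
Qed.

Let upper_sum_gt0 x y : (x != 0) || (y != 0) -> 0 < upper x y + upper (- x) (- y).
Proof.
move=> xy; have xyN : (- x != 0) || (- y != 0) by rewrite !oppr_eq0.
have [_ /andP[u _] _] := rootsP xy; have [_ /andP[uN _] _] := rootsP xyN.
by have := n_gt0 xy; rewrite nN in uN; lra.
Qed.

Let cubic_roots x y s : (x != 0) || (y != 0) -> cubic a x y s = 0 ->
  [\/ s = middle x y, s = upper x y | s = - upper (- x) (- y)].
Proof.
move=> xy s0; have [mn un [r1 r1n E]] := rootsP xy.
have xyN : (- x != 0) || (- y != 0) by rewrite !oppr_eq0.
move: (s0); rewrite E => /eqP; rewrite !mulf_eq0 !subr_eq0 gt_eqF//=.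
move=> /orP[/orP[|]|] /eqP sE; [apply: Or33|by apply: Or31|by apply: Or32].
apply: oppr_inj; rewrite opprK; apply: upper_uniq => //.
  by rewrite nN sE; lra.
by rewrite cubicN s0 oppr0.
Qed.

Let n_continuous : continuous (fun q : R * R => n q.1 q.2).
Proof.
move=> q; have qc : {for q, continuous (fun q : R * R => q.1 * q.1 + q.2 * q.2)} by prove_cvg.
exact: (cvg_comp _ _ qc (@sqrt_continuous R _)).
Qed.

Let nN_continuous : continuous (fun q : R * R => - n q.1 q.2).
Proof. by move=> q; apply: cvgN; exact: n_continuous. Qed.

Let slice_continuous s (q : R * R) :
  {for q, continuous (fun q : R * R => cubic a q.1 q.2 s)}.
Proof.
by apply: (@cubic_continuous R _ (fun=> a) (fun q : R * R => q.1)
  (fun q => q.2) (fun=> s));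
  prove_cvg.
Qed.

Let near_neq00 (q : R * R) : (q.1 != 0) || (q.2 != 0) ->
  \forall p \near q, (p.1 != 0) || (p.2 != 0).
Proof.
move=> q0; have := near_gt (@n_continuous q) (n_gt0 q0).
apply: filterS => p; apply: contraTT; rewrite negb_or !negbK => /andP[/eqP-> /eqP->].
by rewrite /n expr0n addr0 sqrtr0 ltxx.
Qed.

Let middle_continuous (q : R * R) : (q.1 != 0) || (q.2 != 0) ->
  {for q, continuous (fun q => middle q.1 q.2)}.
Proof.
move=> q0; have [/andP[mn nm] _ _] := rootsP q0.
apply: continuous_of_lt_gt => s sm.
  pose u := Num.max s ((- n q.1 q.2 + middle q.1 q.2) / 2).
  have un : - n q.1 q.2 < u by rewrite /u lt_max; apply/orP; right; lra.
  have um : u < middle q.1 q.2 by rewrite /u gt_max sm; lra.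
  have su : s <= u by rewrite /u le_max lexx.
  have un' := lt_trans um nm.
  have cu : 0 < cubic a q.1 q.2 u by rewrite -middle_gt// un.
  have h1 := nbhsI (near_gt (@slice_continuous u q) cu) (near_neq00 q0).
  have h2 := nbhsI (near_lt (@nN_continuous q) un) (near_gt (@n_continuous q) un').
  have := nbhsI h1 h2; apply: filterS => p [[cp p0] [np pn]].
  by apply: (le_lt_trans su); rewrite middle_gt// np.
pose u := Num.min s ((n q.1 q.2 + middle q.1 q.2) / 2).
have un : u < n q.1 q.2 by rewrite /u gt_min; apply/orP; right; lra.
have um : middle q.1 q.2 < u by rewrite /u lt_min sm; lra.
have su : u <= s by rewrite /u ge_min lexx.
have un' := lt_trans mn um.
have cu : cubic a q.1 q.2 u < 0 by rewrite -middle_lt// un'.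
have h1 := nbhsI (near_lt (@slice_continuous u q) cu) (near_neq00 q0).
have h2 := nbhsI (near_lt (@nN_continuous q) un') (near_gt (@n_continuous q) un).
have := nbhsI h1 h2; apply: filterS => p [[cp p0] [np pn]].
by apply: (lt_le_trans _ su); rewrite middle_lt// np.
Qed.

Let upper_bounds x y : 0 <= upper x y <= 4 * n x y.
Proof.
have [xy|] := boolP ((x != 0) || (y != 0)).
  by have [_ /andP[h1 h2] _] := rootsP xy; have := n_gt0 xy; lra.
rewrite negb_or !negbK => /andP[/eqP-> /eqP->]; rewrite upper0 lexx.
by rewrite mulr_ge0// sqrtr_ge0.
Qed.

(* At the origin, continuity follows from the bound by four times the norm. *)
Let upper_continuous : continuous (fun q : R * R => upper q.1 q.2).
Proof.
move=> q; have [q0|q0] := boolP ((q.1 != 0) || (q.2 != 0)); last first.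
  have E : upper q.1 q.2 = 0 /\ n q.1 q.2 = 0.
    move: q0; rewrite negb_or !negbK => /andP[/eqP-> /eqP->].
    by rewrite upper0 /n expr0n addr0 sqrtr0.
  apply: continuous_of_lt_gt => s; rewrite E.1 => s0.
    have qT : nbhs q setT by exact: filterT.
    apply: filterS qT => p _; apply: (lt_le_trans s0).
    by have /andP[] := upper_bounds p.1 p.2.
  have s4 : n q.1 q.2 < s / 4 by rewrite E.2; lra.
  have := near_lt (@n_continuous q) s4; apply: filterS => p ps.
  by have /andP[_ h] := upper_bounds p.1 p.2; apply: (le_lt_trans h); lra.
have [_ /andP[nu _] _] := rootsP q0.
apply: continuous_of_lt_gt => s su.
  pose u := Num.max s ((n q.1 q.2 + upper q.1 q.2) / 2).
  have un : n q.1 q.2 < u by rewrite /u lt_max; apply/orP; right; lra.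
  have um : u < upper q.1 q.2 by rewrite /u gt_max su; lra.
  have su' : s <= u by rewrite /u le_max lexx.
  have cu : cubic a q.1 q.2 u < 0 by rewrite -upper_gt.
  have h := nbhsI (near_lt (@slice_continuous u q) cu) (near_neq00 q0).
  have := nbhsI h (near_lt (@n_continuous q) un); apply: filterS => p [[cp p0] np].
  by apply: (le_lt_trans su'); rewrite upper_gt.
have ns := lt_trans nu su.
have cs : 0 < cubic a q.1 q.2 s by rewrite -upper_lt.
have h := nbhsI (near_gt (@slice_continuous s q) cs) (near_neq00 q0).
have := nbhsI h (near_lt (@n_continuous q) ns).
by apply: filterS => p [[cp p0] np]; rewrite upper_lt.
Qed.

(** The middle root is an odd function of the direction and its graph is a
    pseudo-line. The largest root exceeds the smallest one, which is its
    antipode, and its graph is an oval. *)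
Theorem has_one_oval : has_ovals 1 (cubic_of a).
Proof.
split; first by rewrite cubic_of_neq0// gt_eqF.
exists (fun=> graph upper), (graph middle); split.
- move=> _; apply: oval_graph; [exact: upperZ|exact: upper_continuous|].
  exact: upper_sum_gt0.
- exact: (pseudo_line_graph middleZ middle_continuous).
- by move=> i j _ _ _; rewrite (ord1 i) (ord1 j).
- move=> _; apply/seteqP; split=> // P [[x [y [xy0 ->]]]].
  have nz : vec x y (upper x y) != 0 by rewrite vec_neq0 orbA xy0.
  move=> /(in_odd_graph middleZ nz)[_ E].
  by have [/andP[_ h1] /andP[h2 _] _] := rootsP xy0; rewrite E in h2; lra.
- rewrite (_ : \bigcup_i _ = graph upper); last first.
    by apply/seteqP; split=> [P [_ _]//|P PU]; exists ord0.
  apply/seteqP; split=> P.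
    move=> /zero_locusP[x [y [z [v0 PE fv]]]].
    have xy : (x != 0) || (y != 0).
      rewrite -negb_and; apply/negP => /andP[/eqP x0 /eqP y0].
      move: fv; rewrite x0 y0 /cubic !(mul0r, mulr0, add0r) => /eqP.
      rewrite !mulf_eq0 gt_eqF//= !orbb => /eqP z0.
      by move: v0; rewrite x0 y0 z0 vec0 eqxx.
    rewrite PE; have [zE|zE|zE] := cubic_roots xy fv.
    + by right; apply/(in_odd_graph middleZ v0).
    + by left; apply/(in_graph upperZ v0); split=> //; left.
    + by left; apply/(in_graph upperZ v0); split=> //; right.
  move=> [|] [x [y [xy0 ->]]]; apply/zero_locusP.
    exists x, y, (upper x y); split=> //; last exact: cubic_upper.
    by rewrite vec_neq0 orbA xy0.
  exists x, y, (middle x y); split=> //; last exact: cubic_middle.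
  by rewrite vec_neq0 orbA xy0.
Qed.

End OneOval.

(** * Zeros of perturbed maps *)

Section PerturbedIdentity.
Context (R : realType).

(** At a minimum of the norm of [G] on [B] the value is zero, for otherwise the
    step from x to x - G x, which stays in [B], would halve the norm. *)
Lemma perturbed_identity_zero (X : normedModType R) (B : set X) (G : X -> X) :
  compact B -> B !=set0 ->
  (forall x y, B x -> B y -> `|G x - G y - (x - y)| <= 2^-1 * `|x - y|) ->
  (forall x, B x -> B (x - G x)) ->
  exists x, [/\ B x, G x = 0 & forall y, B y -> G y = 0 -> y = x].
Proof.
move=> cB B0 Glip Bstable.
have Gcont : {within B, continuous (fun x => `|G x|)}.
  apply/subspace_continuousP => x Bx; rewrite /from_subspace.
  apply/cvgrPdist_lt => e e0; rewrite near_withinE.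
  have /nbhs_ballP [d d0 dball] : nbhs x (ball x (e / 2)).
    by apply/nbhs_ballP; exists (e / 2); rewrite //= divr_gt0.
  apply/nbhs_ballP; exists (e / 2); first by rewrite /= divr_gt0.
  move=> y /=; rewrite -ball_normE /= => xy By.
  have h := Glip _ _ Bx By.
  have h1 := ler_dist_dist (G x) (G y).
  have h2 := ler_normD (G x - G y - (x - y)) (x - y).
  rewrite subrK in h2.
  apply: (le_lt_trans h1); apply: (le_lt_trans h2).
  by lra.
have [c Bc cmin] := compact_EVT_min B0 cB Gcont.
have {}Bc := set_mem Bc.
have Gc : G c = 0.
  have Bc' := Bstable _ Bc; have := cmin _ (mem_set Bc').
  have := Glip _ _ Bc' Bc.
  have -> : G (c - G c) - G c - (c - G c - c) = G (c - G c).
    by rewrite [c - G c - c]addrAC subrr add0r opprK subrK.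
  rewrite [c - G c - c]addrAC subrr add0r normrN => h1 h2.
  by apply/eqP; rewrite -normr_le0; lra.
exists c; split=> // y By Gy.
have := Glip _ _ By Bc; rewrite Gy Gc subrr sub0r normrN => h.
by apply/eqP; rewrite -subr_eq0 -normr_le0; lra.
Qed.

Lemma closed_square_compact (w : R * R) r :
  compact [set p : R * R | `|p - w| <= r].
Proof.
rewrite (_ : [set p | _] = `[(w.1 - r), (w.1 + r)] `*` `[(w.2 - r), (w.2 + r)]).
  by apply: compact_setX; exact: segment_compact.
apply/seteqP; split=> p /=; rewrite prod_normE ge_max !in_itv/= !ler_norml.
  by move=> /andP[/andP[? ?] /andP[? ?]]; split; apply/andP; split; lra.
by move=> [/andP[? ?] /andP[? ?]]; apply/andP; split; apply/andP; split; lra.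
Qed.

(** The hypotheses give the increments of [P] and [Q] by divided differences,
    which can be bounded uniformly on a neighbourhood of the base point. *)
Section ParametrizedZero.
Context (T : topologicalType) (t0 : T) (w0 : R * R).
Variables (P Q : T -> R * R -> R) (p1 p2 q1 q2 : T * (R * R) * (R * R) -> R).
Hypothesis PB : forall t w w', P t w - P t w' =
  p1 (t, w, w') * (w.1 - w'.1) + p2 (t, w, w') * (w.2 - w'.2).
Hypothesis QB : forall t w w', Q t w - Q t w' =
  q1 (t, w, w') * (w.1 - w'.1) + q2 (t, w, w') * (w.2 - w'.2).
Let base := (t0, w0, w0).
Hypothesis p1c : {for base, continuous p1}.
Hypothesis p2c : {for base, continuous p2}.
Hypothesis q1c : {for base, continuous q1}.
Hypothesis q2c : {for base, continuous q2}.
Hypothesis Pc : {for t0, continuous (P ^~ w0)}.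
Hypothesis Qc : {for t0, continuous (Q ^~ w0)}.
Hypothesis P0 : P t0 w0 = 0.
Hypothesis Q0 : Q t0 w0 = 0.
Hypothesis det_neq0 : p1 base * q2 base - p2 base * q1 base != 0.

Let D := p1 base * q2 base - p2 base * q1 base.

(* The inverse of the Jacobian matrix, applied to (u, v). *)
Let comb1 (u v : R) := (q2 base * u - p2 base * v) / D.
Let comb2 (u v : R) := (p1 base * v - q1 base * u) / D.

Let near_le (f : T * (R * R) * (R * R) -> R) c : {for base, continuous f} ->
  f base = c -> \forall z \near base, `|f z - c| <= 4^-1.
Proof.
move=> fc fE.
have gc : {for base, continuous (fun z => `|f z - c|)}.
  apply: cvg_norm; prove_cvg.
have : `|f base - c| < 4^-1 by rewrite fE subrr normr0 invr_gt0.
by move=> /(near_lt gc); apply: filterS => z /ltW.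
Qed.

(** Composed with the inverse of the Jacobian matrix at the base point, the pair
    ([P], [Q]) has divided differences close to the identity matrix, so that
    [perturbed_identity_zero] applies on small squares. *)
Lemma parametrized_zero : \forall r \near 0^'+, \forall t \near t0,
  exists w, [/\ `|w - w0| <= r, P t w = 0, Q t w = 0 &
    forall w', `|w' - w0| <= r -> P t w' = 0 -> Q t w' = 0 -> w' = w].
Proof.
have D0 : D != 0 by [].
pose n11 z := comb1 (p1 z) (q1 z); pose n12 z := comb1 (p2 z) (q2 z).
pose n21 z := comb2 (p1 z) (q1 z); pose n22 z := comb2 (p2 z) (q2 z).
have c11 : {for base, continuous n11} by rewrite /n11 /comb1; prove_cvg.
have c12 : {for base, continuous n12} by rewrite /n12 /comb1; prove_cvg.
have c21 : {for base, continuous n21} by rewrite /n21 /comb2; prove_cvg.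
have c22 : {for base, continuous n22} by rewrite /n22 /comb2; prove_cvg.
have e11 : n11 base = 1 by rewrite /n11 /comb1 /D; field.
have e12 : n12 base = 0 by rewrite /n12 /comb1 /D; field.
have e21 : n21 base = 0 by rewrite /n21 /comb2 /D; field.
have e22 : n22 base = 1 by rewrite /n22 /comb2 /D; field.
have := nbhsI (nbhsI (near_le c11 e11) (near_le c12 e12))
  (nbhsI (near_le c21 e21) (near_le c22 e22)).
(* A neighbourhood of the base point contains a product of neighbourhoods. *)
move=> [[A1 A2] [/= A1n A2n] Asub].
have {A1n} [[U V] [/= Un Vn] UV] := A1n.
have /nbhs_ballP[d d0 dV] : nbhs w0 (V `&` A2) by exact: filterI.
have E t w w' : U t -> `|w - w0| < d -> `|w' - w0| < d ->
  [/\ `|n11 (t, w, w') - 1| <= 4^-1, `|n12 (t, w, w')| <= 4^-1,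
      `|n21 (t, w, w')| <= 4^-1 & `|n22 (t, w, w') - 1| <= 4^-1].
  move=> Ut wd wd'.
  have [Vw _] : (V `&` A2) w by apply: dV; rewrite ball_prod_normE /ball_/= distrC.
  have [_ Aw'] : (V `&` A2) w' by apply: dV; rewrite ball_prod_normE /ball_/= distrC.
  have A1w : A1 (t, w) by apply: UV.
  have [/= [h1 h2] [h3 h4]] := Asub (t, w, w') (conj A1w Aw').
  by move: h2 h3; rewrite !subr0 => h2 h3; split.
near=> r.
have r0 : 0 < r by [].
have rd : r < d by near: r; exact: nbhs_right_lt.
pose G t w : R * R := (comb1 (P t w) (Q t w), comb2 (P t w) (Q t w)).
have G1c : {for t0, continuous (fun t => `|comb1 (P t w0) (Q t w0)|)}.
  by apply: cvg_norm; rewrite /comb1; prove_cvg.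
have G2c : {for t0, continuous (fun t => `|comb2 (P t w0) (Q t w0)|)}.
  by apply: cvg_norm; rewrite /comb2; prove_cvg.
have near1 : \forall t \near t0, `|comb1 (P t w0) (Q t w0)| < r / 2.
  by apply: near_lt => //; rewrite /comb1 P0 Q0 !mulr0 subrr mul0r normr0 divr_gt0.
have near2 : \forall t \near t0, `|comb2 (P t w0) (Q t w0)| < r / 2.
  by apply: near_lt => //; rewrite /comb2 P0 Q0 !mulr0 subrr mul0r normr0 divr_gt0.
apply: filterS (nbhsI Un (nbhsI near1 near2)) => t [Ut [G1 G2]].
pose B := [set w : R * R | `|w - w0| <= r].
have Glip w w' : B w -> B w' -> `|G t w - G t w' - (w - w')| <= 2^-1 * `|w - w'|.
  move=> Bw Bw'.
  have [h11 h12 h21 h22] := E t w w' Ut (le_lt_trans Bw rd) (le_lt_trans Bw' rd).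
  have le1 : `|w.1 - w'.1| <= `|w - w'| by rewrite [leRHS]prod_normE le_max lexx.
  have le2 : `|w.2 - w'.2| <= `|w - w'| by rewrite [leRHS]prod_normE le_max lexx orbT.
  have n0 := normr_ge0 (w - w').
  have bound (u v : R) : `|u| <= 4^-1 -> `|v| <= 4^-1 ->
      `|u * (w.1 - w'.1) + v * (w.2 - w'.2)| <= 2^-1 * `|w - w'|.
    move=> hu hv; apply: (le_trans (ler_normD _ _)); rewrite !normrM.
    have h1 := ler_pM (normr_ge0 u) (normr_ge0 _) hu le1.
    have h2 := ler_pM (normr_ge0 v) (normr_ge0 _) hv le2.
    by lra.
  rewrite [leLHS]prod_normE ge_max; apply/andP; split.
    have -> : (G t w - G t w' - (w - w')).1 =
        (n11 (t, w, w') - 1) * (w.1 - w'.1) + n12 (t, w, w') * (w.2 - w'.2).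
      rewrite /G /= -[comb1 (P t w) _ - _]/(_ - _).
      have -> : comb1 (P t w) (Q t w) - comb1 (P t w') (Q t w') =
          comb1 (P t w - P t w') (Q t w - Q t w') by rewrite /comb1; field.
      by rewrite PB QB /n11 /n12 /comb1; field.
    exact: bound.
  have -> : (G t w - G t w' - (w - w')).2 =
      n21 (t, w, w') * (w.1 - w'.1) + (n22 (t, w, w') - 1) * (w.2 - w'.2).
    rewrite /G /=.
    have -> : comb2 (P t w) (Q t w) - comb2 (P t w') (Q t w') =
        comb2 (P t w - P t w') (Q t w - Q t w') by rewrite /comb2; field.
    by rewrite PB QB /n21 /n22 /comb2; field.
  exact: bound.
have Bw0 : B w0 by rewrite /B/= subrr normr0 ltW.
have [|w [Bw Gw wuniq]] := @perturbed_identity_zero _ B (G t)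
  (@closed_square_compact _ _) (ex_intro _ w0 Bw0) Glip.
  move=> w Bw; rewrite /B /=.
  have h := Glip _ _ Bw Bw0.
  have -> : w - G t w - w0 = - (G t w - G t w0 - (w - w0)) - G t w0.
    move: (G t w) (G t w0) => g g0.
    by rewrite !opprB -!addrA (addrCA g0) subrr addr0 [- w0 + _]addrC.
  apply: (le_trans (ler_normB _ _)); rewrite normrN.
  have : `|G t w0| <= r / 2 by rewrite prod_normE ge_max /= !ltW.
  by move: Bw; rewrite /B/=; lra.
have combK u v : comb1 u v = 0 -> comb2 u v = 0 -> u = 0 /\ v = 0.
  move=> h1 h2.
  have uE : u = p1 base * comb1 u v + p2 base * comb2 u v.
    by rewrite /comb1 /comb2 /D; field.
  have vE : v = q1 base * comb1 u v + q2 base * comb2 u v.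
    by rewrite /comb1 /comb2 /D; field.
  by split; [rewrite uE|rewrite vE]; rewrite h1 h2 !mulr0 addr0.
exists w.
have [Pw Qw] := combK _ _ (congr1 fst Gw) (congr1 snd Gw).
split=> // w' Bw' Pw' Qw'; apply: wuniq => //.
by rewrite /G Pw' Qw' /comb1 /comb2 !mulr0 subrr mul0r.
Unshelve. all: by end_near. Qed.

End ParametrizedZero.

End PerturbedIdentity.

(** * Eigenpoints of nearby cubics *)

Section EigenpointStability.
Context (R : realType).
Implicit Types (a : 'rV[R]_10) (x y z k : R).

Lemma near_pos_on_compact (X T : topologicalType) (K : set X) (f : X * T -> R) (t0 : T) :
  compact K -> (forall q, K q -> {for (q, t0), continuous f}) ->
  (forall q, K q -> 0 < f (q, t0)) ->
  \forall t \near t0, forall q, K q -> 0 < f (q, t).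
Proof.
move=> /compact_near_coveringP cK fc f0.
apply: (cK T (nbhs t0) (fun t q => 0 < f (q, t))) => q Kq.
have := near_gt (fc _ Kq) (f0 _ Kq).
by apply: filterS => -[].
Qed.

Definition eigenvector a x y z : Prop := exists l,
  [/\ cubic_x a x y z = l * x, cubic_y a x y z = l * y & cubic_z a x y z = l * z].

Lemma cubic_xZ a k x y z :
  cubic_x a (k * x) (k * y) (k * z) = k ^+ 2 * cubic_x a x y z.
Proof. by rewrite /cubic_x; ring. Qed.

Lemma cubic_yZ a k x y z :
  cubic_y a (k * x) (k * y) (k * z) = k ^+ 2 * cubic_y a x y z.
Proof. by rewrite /cubic_y; ring. Qed.

Lemma cubic_zZ a k x y z :
  cubic_z a (k * x) (k * y) (k * z) = k ^+ 2 * cubic_z a x y z.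
Proof. by rewrite /cubic_z; ring. Qed.

Lemma eigenvectorZ a k x y z :
  eigenvector a x y z -> eigenvector a (k * x) (k * y) (k * z).
Proof.
move=> [l [xE yE zE]]; exists (k * l).
by rewrite cubic_xZ cubic_yZ cubic_zZ xE yE zE; split; ring.
Qed.

Lemma eigenpointsP a (P : projective_plane R) :
  eigenpoints (cubic_of a) P <-> exists x y z,
    [/\ vec x y z != 0, P = point (vec x y z) & eigenvector a x y z].
Proof.
split=> [[v /= [l vl] <-]|[x [y [z [v0 -> [l [xE yE zE]]]]]]].
  exists (val v 0 0), (val v 0 1), (val v 0 2%R); rewrite -vec_eta nonzero_val.
  split=> //; first by rewrite -proj_pointE.
  exists l; move: vl; rewrite gradient_cubic_of => /rowP e.
  by have := (e 0, e 1, e 2%R); rewrite !mxE /= => -[[-> ->] ->].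
exists (insubd (default_vector R) (vec x y z)) => //=.
exists l; rewrite (val_insubd_neq0 v0) gradient_cubic_of !vecE vecZ.
by rewrite xE yE zE.
Qed.

(** The two components of grad f - (df/dz) v in the chart z = 1, whose common
    zeros are the eigenpoints of the chart. *)
Definition eigen_x a (w : R * R) := cubic_x a w.1 w.2 1 - w.1 * cubic_z a w.1 w.2 1.
Definition eigen_y a (w : R * R) := cubic_y a w.1 w.2 1 - w.2 * cubic_z a w.1 w.2 1.

Lemma eigenvector_chart a (w : R * R) :
  eigenvector a w.1 w.2 1 <-> eigen_x a w = 0 /\ eigen_y a w = 0.
Proof.
rewrite /eigen_x /eigen_y; split=> [[l [-> -> ->]]|[/eqP + /eqP]].
  by split; ring.
rewrite !subr_eq0 => /eqP xE /eqP yE; exists (cubic_z a w.1 w.2 1).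
by rewrite xE yE; split; ring.
Qed.

(* Divided differences of eigen_x and eigen_y: their values on the diagonal are
   the partial derivatives. *)
Let point3 := ('rV[R]_10 * (R * R) * (R * R))%type.
Let zx (p : point3) := let: (a, w, v) := p in
  coef a 2 * (w.1 + v.1) + coef a 4 * w.2 + 2 * coef a 5.
Let zy (p : point3) := let: (a, w, v) := p in
  coef a 4 * v.1 + coef a 7 * (w.2 + v.2) + 2 * coef a 8.
Definition dxx (p : point3) := let: (a, w, v) := p in
  3 * coef a 0 * (w.1 + v.1) + 2 * coef a 1 * w.2 + 2 * coef a 2
  - cubic_z a w.1 w.2 1 - v.1 * zx p.
Definition dxy (p : point3) := let: (a, w, v) := p in
  2 * coef a 1 * v.1 + coef a 3 * (w.2 + v.2) + coef a 4 - v.1 * zy p.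
Definition dyx (p : point3) := let: (a, w, v) := p in
  coef a 1 * (w.1 + v.1) + 2 * coef a 3 * w.2 + coef a 4 - v.2 * zx p.
Definition dyy (p : point3) := let: (a, w, v) := p in
  2 * coef a 3 * v.1 + 3 * coef a 6 * (w.2 + v.2) + 2 * coef a 7
  - cubic_z a w.1 w.2 1 - v.2 * zy p.

Lemma eigen_xB a w v : eigen_x a w - eigen_x a v =
  dxx (a, w, v) * (w.1 - v.1) + dxy (a, w, v) * (w.2 - v.2).
Proof. by rewrite /eigen_x /dxx /dxy /zx /zy /cubic_x /cubic_z; ring. Qed.

Lemma eigen_yB a w v : eigen_y a w - eigen_y a v =
  dyx (a, w, v) * (w.1 - v.1) + dyy (a, w, v) * (w.2 - v.2).
Proof. by rewrite /eigen_y /dyx /dyy /zx /zy /cubic_y /cubic_z; ring. Qed.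

Definition nondegenerate a (w : R * R) : Prop :=
  dxx (a, w, w) * dyy (a, w, w) - dxy (a, w, w) * dyx (a, w, w) != 0.

Lemma continuous_triple (f g : point3 -> R) p :
  (forall a w v, f (a, w, v) = g (a, w, v)) ->
  {for p, continuous g} -> {for p, continuous f}.
Proof. by move=> fg; rewrite (_ : f = g)//; apply/funext => -[[]]. Qed.

Lemma dxx_continuous p : {for p, continuous dxx}.
Proof.
apply: (@continuous_triple _ (fun p => 3 * coef p.1.1 0 * (p.1.2.1 + p.2.1)
  + 2 * coef p.1.1 1 * p.1.2.2 + 2 * coef p.1.1 2 - cubic_z p.1.1 p.1.2.1 p.1.2.2 1
  - p.2.1 * (coef p.1.1 2 * (p.1.2.1 + p.2.1) + coef p.1.1 4 * p.1.2.2 + 2 * coef p.1.1 5))) => //.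
by rewrite /cubic_z /coef; prove_cvg.
Qed.

Lemma dxy_continuous p : {for p, continuous dxy}.
Proof.
apply: (@continuous_triple _ (fun p => 2 * coef p.1.1 1 * p.2.1
  + coef p.1.1 3 * (p.1.2.2 + p.2.2) + coef p.1.1 4
  - p.2.1 * (coef p.1.1 4 * p.2.1 + coef p.1.1 7 * (p.1.2.2 + p.2.2) + 2 * coef p.1.1 8))) => //.
by rewrite /cubic_z /coef; prove_cvg.
Qed.

Lemma dyx_continuous p : {for p, continuous dyx}.
Proof.
apply: (@continuous_triple _ (fun p => coef p.1.1 1 * (p.1.2.1 + p.2.1)
  + 2 * coef p.1.1 3 * p.1.2.2 + coef p.1.1 4
  - p.2.2 * (coef p.1.1 2 * (p.1.2.1 + p.2.1) + coef p.1.1 4 * p.1.2.2 + 2 * coef p.1.1 5))) => //.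
by rewrite /cubic_z /coef; prove_cvg.
Qed.

Lemma dyy_continuous p : {for p, continuous dyy}.
Proof.
apply: (@continuous_triple _ (fun p => 2 * coef p.1.1 3 * p.2.1
  + 3 * coef p.1.1 6 * (p.1.2.2 + p.2.2) + 2 * coef p.1.1 7 - cubic_z p.1.1 p.1.2.1 p.1.2.2 1
  - p.2.2 * (coef p.1.1 4 * p.2.1 + coef p.1.1 7 * (p.1.2.2 + p.2.2) + 2 * coef p.1.1 8))) => //.
by rewrite /cubic_z /coef; prove_cvg.
Qed.

Lemma near_unique_eigenpoint a0 (w0 : R * R) :
  eigen_x a0 w0 = 0 -> eigen_y a0 w0 = 0 -> nondegenerate a0 w0 ->
  \forall r \near 0^'+, \forall a \near a0,
  exists w, [/\ `|w - w0| <= r, eigen_x a w = 0, eigen_y a w = 0 &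
    forall w', `|w' - w0| <= r -> eigen_x a w' = 0 -> eigen_y a w' = 0 -> w' = w].
Proof.
move=> x0 y0 nd.
apply: (parametrized_zero eigen_xB eigen_yB) => //.
- exact: dxx_continuous.
- exact: dxy_continuous.
- exact: dyx_continuous.
- exact: dyy_continuous.
- by rewrite /eigen_x /cubic_x /cubic_z /coef; prove_cvg.
- by rewrite /eigen_y /cubic_y /cubic_z /coef; prove_cvg.
Qed.

(** The components of the cross product of v and grad f (v). *)
Definition minor_xy a (v : 'rV[R]_3) := v 0 0 * cubic_y a (v 0 0) (v 0 1) (v 0 2%R)
  - v 0 1 * cubic_x a (v 0 0) (v 0 1) (v 0 2%R).
Definition minor_xz a (v : 'rV[R]_3) := v 0 0 * cubic_z a (v 0 0) (v 0 1) (v 0 2%R)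
  - v 0 2%R * cubic_x a (v 0 0) (v 0 1) (v 0 2%R).
Definition minor_yz a (v : 'rV[R]_3) := v 0 1 * cubic_z a (v 0 0) (v 0 1) (v 0 2%R)
  - v 0 2%R * cubic_y a (v 0 0) (v 0 1) (v 0 2%R).

Definition eigenvec a (v : 'rV[R]_3) := eigenvector a (v 0 0) (v 0 1) (v 0 2%R).

Lemma eigenvec_minors a (v : 'rV[R]_3) : v != 0 ->
  eigenvec a v <-> [/\ minor_xy a v = 0, minor_xz a v = 0 & minor_yz a v = 0].
Proof.
rewrite (vec_eta v) vec_neq0 /eigenvec /eigenvector /minor_xy /minor_xz /minor_yz !vecE.
move: (v 0 0) (v 0 1) (v 0 2%R) => x y z v0; split=> [[l [-> -> ->]]|[]].
  by split; ring.
move: (cubic_x _ _ _ _) (cubic_y _ _ _ _) (cubic_z _ _ _ _) v0 => p q s.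
move=> n0 /eqP + /eqP + /eqP; rewrite !subr_eq0 => /eqP h1 /eqP h2 /eqP h3.
case/or3P: n0 => n0.
- exists (p / x); split; first by rewrite divfK.
    by apply: (mulfI n0); rewrite h1; field.
  by apply: (mulfI n0); rewrite h2; field.
- exists (q / y); split; last by apply: (mulfI n0); rewrite h3; field.
    by apply: (mulfI n0); rewrite -h1; field.
  by rewrite divfK.
- exists (s / z); split; last by rewrite divfK.
    by apply: (mulfI n0); rewrite -h2; field.
  by apply: (mulfI n0); rewrite -h3; field.
Qed.

Lemma minors_continuous (p : 'rV[R]_3 * 'rV[R]_10) :
  [/\ {for p, continuous (fun p => minor_xy p.2 p.1)},
      {for p, continuous (fun p => minor_xz p.2 p.1)} &
      {for p, continuous (fun p => minor_yz p.2 p.1)}].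
Proof.
by split; rewrite /minor_xy /minor_xz /minor_yz /cubic_x /cubic_y /cubic_z /coef; prove_cvg.
Qed.

Lemma unit_sphere_compact : compact [set v : 'rV[R]_3 | `|v| = 1].
Proof.
apply: bounded_closed_compact.
  by exists 1; split=> // M M1 v /= ->; exact: ltW.
rewrite (_ : [set v | _] = Num.norm @^-1` [set r : R | r = 1])//.
by apply: closed_comp; [move=> v _; exact: norm_continuous|exact: closed_eq].
Qed.

Section Stability.
Variables (a0 : 'rV[R]_10) (m : nat) (pts : 'I_m -> R * R).
Hypothesis pts_inj : injective pts.
Hypothesis pts_zero : forall i, eigen_x a0 (pts i) = 0 /\ eigen_y a0 (pts i) = 0.
Hypothesis pts_nondegenerate : forall i, nondegenerate a0 (pts i).
Hypothesis pts_complete : forall x y z, vec x y z != 0 -> eigenvector a0 x y z ->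
  z != 0 /\ exists i, (x / z, y / z) = pts i.

Let chart (v : 'rV[R]_3) : R * R := (v 0 0 / v 0 2%R, v 0 1 / v 0 2%R).

Let chart_continuous (v : 'rV[R]_3) : v 0 2%R != 0 -> {for v, continuous chart}.
Proof.
move=> v2; have vc : {for v, continuous (fun v : 'rV[R]_3 => (v 0 2%R)^-1)}.
  by rewrite /prop_for /continuous_at; apply: (cvgV (F := nbhs v)) => //; prove_cvg.
by rewrite /chart; prove_cvg.
Qed.

(** An eigenvector of [a0] has neighbours that are close to it in the chart, and
    at any other vector one of the minors is nonzero, also for nearby vectors
    and cubics. Compactness of the sphere makes this uniform. *)
Lemma near_eigenvectors_close r : 0 < r ->
  \forall a \near a0, forall v : 'rV[R]_3, `|v| = 1 -> eigenvec a v ->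
    v 0 2%R != 0 /\ exists i, `|chart v - pts i| <= r.
Proof.
move=> r0.
have /compact_near_coveringP := unit_sphere_compact.
apply: (_ : near_covering _ -> _) => /(_ _ (nbhs a0) (fun a v => eigenvec a v ->
    v 0 2%R != 0 /\ exists i, `|chart v - pts i| <= r)).
apply=> v v1.
have v0 : v != 0 by rewrite -normr_gt0 v1.
have [c1 c2 c3] := minors_continuous (v, a0).
have not_eigen (f : 'rV[R]_10 -> 'rV[R]_3 -> R) :
    {for (v, a0), continuous (fun p => f p.2 p.1)} -> f a0 v != 0 ->
    (forall a w, w != 0 -> eigenvec a w -> f a w = 0) ->
    \forall w \near v & a \near a0, eigenvec a w ->
      w 0 2%R != 0 /\ exists i, `|chart w - pts i| <= r.
  move=> fc fn f0.
  have n1 := near_neq fc fn.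
  have n2 : \forall p \near (v, a0), p.1 != 0.
    by exists ([set w : 'rV[R]_3 | w != 0], setT) => [|[w a] []//];
      split; [exact: near_neq0|exact: filterT].
  apply: filterS (nbhsI n1 n2) => -[w a] /= [fw w0] ew.
  by rewrite (f0 _ _ w0 ew) eqxx in fw.
have [ev|nev] := pselect (eigenvec a0 v).
  have [z0 [i iE]] : v 0 2%R != 0 /\ exists i, chart v = pts i.
    by apply: pts_complete ev; rewrite -vec_eta.
  have zc : {for v, continuous (fun v : 'rV[R]_3 => v 0 2%R)} by prove_cvg.
  have dc : {for v, continuous (fun w => `|chart w - pts i|)}.
    have cc := chart_continuous z0.
    exact: (cvg_norm (cvgB (F := nbhs v) cc (cvg_cst _))).
  have d0 : `|chart v - pts i| < r by rewrite iE subrr normr0.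
  exists ([set w : 'rV[R]_3 | w 0 2%R != 0] `&` [set w | `|chart w - pts i| < r], setT).
    split; last exact: filterT.
    exact: nbhsI (near_neq zc z0) (near_lt dc d0).
  by move=> [w a] /= [[w2 wi] _] _; split=> //; exists i; exact: ltW.
have [m1|] := eqVneq (minor_xy a0 v) 0; last first.
  by move=> m1; apply: (not_eigen _ c1 m1) => a w w0 /(eigenvec_minors _ w0)[].
have [m2|] := eqVneq (minor_xz a0 v) 0; last first.
  by move=> m2; apply: (not_eigen _ c2 m2) => a w w0 /(eigenvec_minors _ w0)[].
have [m3|] := eqVneq (minor_yz a0 v) 0; last first.
  by move=> m3; apply: (not_eigen _ c3 m3) => a w w0 /(eigenvec_minors _ w0)[].
by case: nev; apply/eigenvec_minors.
Qed.

(** Disjoint squares around the given points contain one eigenpoint each, and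
    together they contain all of them. *)
Theorem near_card_eigenpoints :
  \forall a \near a0, (eigenpoints (cubic_of a) #= `I_m)%card.
Proof.
pose unique_zero r i a := exists w, [/\ `|w - pts i| <= r, eigen_x a w = 0,
  eigen_y a w = 0 & forall w', `|w' - pts i| <= r ->
    eigen_x a w' = 0 -> eigen_y a w' = 0 -> w' = w].
have loc : \forall r \near (0 : R)^'+, forall i, \forall a \near a0, unique_zero r i a.
  apply: filter_forall => i; have [x0 y0] := pts_zero i.
  exact: near_unique_eigenpoint.
have sep : \forall r \near (0 : R)^'+, forall ij : 'I_m * 'I_m, ij.1 != ij.2 ->
    r + r < `|pts ij.1 - pts ij.2|.
  apply: filter_forall => -[i j] /=; have [->|ij] := eqVneq i j.
    by near=> r.
  have d0 : 0 < `|pts i - pts j| / 2.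
    by rewrite divr_gt0// normr_gt0 subr_eq0; apply: contra ij => /eqP/pts_inj->.
  near=> r => _; have : r < `|pts i - pts j| / 2 by near: r; exact: nbhs_right_lt.
  lra.
near (0 : R)^'+ => r.
have r0 : 0 < r by [].
have sepr (ij : 'I_m * 'I_m) : ij.1 != ij.2 -> r + r < `|pts ij.1 - pts ij.2|.
  by move: ij; near: r; exact: sep.
have locr i : \forall a \near a0, unique_zero r i a by move: i; near: r; exact: loc.
have near_loc : \forall a \near a0, forall i, unique_zero r i a.
  exact: (@filter_forall _ _ (unique_zero r) _ (nbhs_filter a0) locr).
have := nbhsI near_loc (near_eigenvectors_close r0).
apply: filterS => a [loca closea].
have [w wP] := choice loca.
have -> : eigenpoints (cubic_of a) =
    (fun i => point (vec (w i).1 (w i).2 1)) @` [set: 'I_m].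
  apply/seteqP; split=> [P /eigenpointsP[x [y [z [v0 -> ev]]]]|_ [i _ <-]]; last first.
    apply/eigenpointsP; exists (w i).1, (w i).2, 1; split=> //.
      by rewrite vec_neq0 oner_eq0 !orbT.
    by apply/eigenvector_chart; have [_ ? ? _] := wP i.
  pose k := `|vec x y z|^-1; have k0 : k != 0 by rewrite invr_eq0 normr_eq0.
  have [] := closea (k *: vec x y z).
  - by rewrite normrZ normfV normr_id mulVf// normr_eq0.
  - by rewrite /eigenvec vecZ !vecE; exact: eigenvectorZ.
  rewrite /chart vecZ !vecE mulf_eq0 (negbTE k0)/= => z0 [i].
  have -> : k * x / (k * z) = x / z by field; rewrite z0 k0.
  have -> : k * y / (k * z) = y / z by field; rewrite z0 k0.
  move=> di; exists i => //.
  have [xw yw] : eigen_x a (x / z, y / z) = 0 /\ eigen_y a (x / z, y / z) = 0.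
    apply/eigenvector_chart => /=; have := eigenvectorZ z^-1 ev.
    by rewrite mulVf// ![z^-1 * _]mulrC.
  have [_ _ _ /(_ _ di xw yw) <-] := wP i.
  rewrite /= -(@pointZ _ z)//; last by rewrite vec_neq0 oner_eq0 !orbT.
  by rewrite vecZ mulr1 ![z * _]mulrC !divfK.
apply: (card_eq_trans (B := [set: 'I_m])).
  apply: inj_card_eq => i j _ _ ptE; apply: contrapT => /eqP ij.
  have nz (u : R * R) : vec u.1 u.2 1 != 0 by rewrite vec_neq0 oner_eq0 !orbT.
  move/(eq_pointP (nz _) (nz _)): ptE => [k k0].
  rewrite vecZ mulr1 => /vec_inj[+ + k1]; rewrite -k1 !mul1r => e1 e2.
  have wij : w j = w i by rewrite [w j]surjective_pairing e1 e2 -surjective_pairing.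
  have [di _ _ _] := wP i; have [dj _ _ _] := wP j; rewrite wij in dj.
  have := sepr (i, j) ij; rewrite /= ltNge => /negP; apply.
  rewrite -[pts i - _](subrKA (w i)) (le_trans (ler_normD _ _))// lerD//.
  by rewrite distrC.
have <- : (@nat_of_ord m) @` [set: 'I_m] = `I_m.
  apply/seteqP; split=> [_ [i _ <-]|k km]; first exact: ltn_ord.
  by exists (Ordinal km).
by rewrite card_eq_sym; apply: inj_card_eq => i j _ _; exact: val_inj.
Unshelve. all: by end_near. Qed.

End Stability.

End EigenpointStability.

(** * Seven cubics *)

Section PositiveVolume.
Context (R : realType).

Lemma positive_volume_near (S : set (ternary_cubic R)) (a0 : 'rV[R]_10) :
  (\forall a \near a0, S (cubic_of a)) -> positive_volume S.
Proof.
move=> /nbhs_ballP[e /= e0 ballS].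
pose t0 : 10.-tuple R := [tuple a0 0 i | i < 10].
exists (box t0 e); split; [exact: measurable_box| |exact: box_volume_gt0].
move=> t tbox; exists (cubic_of (\row_i tnth t i)).
  apply: ballS; split=> // i j; rewrite (ord1 i) mxE -ball_normE /= distrC.
  by have := tbox j; rewrite tnth_mktuple.
by apply: coefficients_cubic_of => i; rewrite mxE.
Qed.

End PositiveVolume.

Section OpenConditions.
Context (R : realType).
Implicit Types (a : 'rV[R]_10) (x y z : R).

(** The hypothesis is homogeneous, so that it suffices to preserve it on the
    unit sphere. *)
Lemma near_has_no_oval a0 :
  (forall x y z, vec x y z != 0 -> 0 < cubic_z a0 x y z) ->
  \forall a \near a0, has_ovals 0 (cubic_of a).
Proof.
move=> pos.
pose f (p : 'rV[R]_3 * 'rV[R]_10) := cubic_z p.2 (p.1 0 0) (p.1 0 1) (p.1 0 2%R).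
have fc p : {for p, continuous f} by rewrite /f /cubic_z /coef; prove_cvg.
have f0 v : `|v| = 1 -> 0 < f (v, a0).
  by move=> v1; apply: pos; rewrite -vec_eta -normr_gt0 v1.
have := @near_pos_on_compact R _ _ _ f a0 (@unit_sphere_compact R) (fun v _ => fc _) f0.
apply: filterS => a apos; apply: has_no_oval => x y z v0.
pose k := `|vec x y z|^-1.
have k0 : 0 < k by rewrite invr_gt0 normr_gt0.
have k1 : `|k *: vec x y z| = 1.
  by rewrite normrZ normfV normr_id mulVf// normr_eq0.
by have := apos _ k1; rewrite /f /= vecZ !vecE cubic_zZ pmulr_rgt0// exprn_gt0.
Qed.

Lemma unit_circle_compact : compact (@unit_circle R).
Proof.
apply: (@subclosed_compact _ _ [set p : R * R | `|p - (0, 0)| <= 1]).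
- rewrite (_ : @unit_circle R = (fun q : R * R => q.1 * q.1 + q.2 * q.2) @^-1` [set r : R | r = 1]).
    by apply: closed_comp; [move=> q _; prove_cvg|exact: closed_eq].
  by apply/seteqP; split=> q; rewrite /unit_circle /= !expr2.
- exact: closed_square_compact.
- move=> q; rewrite /unit_circle /= => q1.
  by rewrite subr0 prod_normE ge_max !ler_norml; apply/andP; split; apply/andP; split; nra.
Qed.

Lemma near_has_one_oval a0 : 0 < coef a0 9 ->
  (forall x y, x ^+ 2 + y ^+ 2 = 1 -> cubic a0 x y 1 < 0) ->
  (forall x y, x ^+ 2 + y ^+ 2 = 1 -> 0 < cubic a0 x y 4) ->
  \forall a \near a0, has_ovals 1 (cubic_of a).
Proof.
move=> lead neg pos.
pose f1 (p : R * R * 'rV[R]_10) := - cubic p.2 p.1.1 p.1.2 1.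
pose f4 (p : R * R * 'rV[R]_10) := cubic p.2 p.1.1 p.1.2 4.
have f1c p : {for p, continuous f1} by rewrite /f1 /cubic /coef; prove_cvg.
have f4c p : {for p, continuous f4} by rewrite /f4 /cubic /coef; prove_cvg.
have f1_gt0 q : unit_circle q -> 0 < f1 (q, a0) by rewrite oppr_gt0; exact: neg.
have f4_gt0 q : unit_circle q -> 0 < f4 (q, a0) by exact: pos.
have n1 := @near_pos_on_compact R _ _ _ f1 a0 unit_circle_compact (fun v _ => f1c _) f1_gt0.
have n4 := @near_pos_on_compact R _ _ _ f4 a0 unit_circle_compact (fun v _ => f4c _) f4_gt0.
have leadc : {for a0, continuous (fun a => coef a 9)} by rewrite /coef; prove_cvg.
have := nbhsI (near_gt leadc lead) (nbhsI n1 n4).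
apply: filterS => a [la [h1 h4]]; apply: has_one_oval => // x y xy.
  by have := h1 (x, y) xy; rewrite /f1 oppr_gt0.
exact: (h4 (x, y) xy).
Qed.

End OpenConditions.

Section Examples.
Context (R : realType).
Implicit Types (al be ga de x y z : R).

(** z^3 + z (al x^2 + be y^2) + x (ga x^2 + de y^2). *)
Definition example al be ga de : 'rV[R]_10 :=
  \row_i [:: ga; 0; al; de; 0; 0; 0; be; 0; 1]`_i.

Lemma coef_example al be ga de k : (k < 10)%N ->
  coef (example al be ga de) k = [:: ga; 0; al; de; 0; 0; 0; be; 0; 1]`_k.
Proof. by move=> k10; rewrite /coef mxE inordK. Qed.

Lemma cubic_example al be ga de x y z : cubic (example al be ga de) x y z =
  z ^+ 3 + z * (al * x ^+ 2 + be * y ^+ 2) + x * (ga * x ^+ 2 + de * y ^+ 2).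
Proof. by rewrite /cubic !coef_example//=; ring. Qed.

Lemma cubic_z_example al be ga de x y z : cubic_z (example al be ga de) x y z =
  al * x ^+ 2 + be * y ^+ 2 + 3 * z ^+ 2.
Proof. by rewrite /cubic_z !coef_example//=; ring. Qed.

Definition critical_x al be ga de x y :=
  3 * ga * x ^+ 2 + 2 * al * x + de * y ^+ 2 - x * (al * x ^+ 2 + be * y ^+ 2 + 3).

Definition critical_y al be ga de x y :=
  y * (2 * de * x + 2 * be - (al * x ^+ 2 + be * y ^+ 2 + 3)).

Definition jacobian al be ga de x y :=
  (6 * ga * x + 2 * al - 3 * al * x ^+ 2 - be * y ^+ 2 - 3)
    * (2 * de * x + 2 * be - al * x ^+ 2 - 3 * be * y ^+ 2 - 3)
  - (2 * de * y - 2 * be * x * y) * (2 * de * y - 2 * al * x * y).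

Lemma eigen_x_example al be ga de x y :
  eigen_x (example al be ga de) (x, y) = critical_x al be ga de x y.
Proof.
by rewrite /eigen_x /critical_x /cubic_x /cubic_z !coef_example//=; ring.
Qed.

Lemma eigen_y_example al be ga de x y :
  eigen_y (example al be ga de) (x, y) = critical_y al be ga de x y.
Proof.
by rewrite /eigen_y /critical_y /cubic_y /cubic_z !coef_example//=; ring.
Qed.

Lemma nondegenerate_example al be ga de x y :
  jacobian al be ga de x y != 0 -> nondegenerate (example al be ga de) (x, y).
Proof.
apply: contra_neq => <-.
by rewrite /jacobian /dxx /dxy /dyx /dyy /cubic_z !coef_example//=; ring.
Qed.

(** No eigenvector has z = 0, because there df/dz is the definite form
    al x^2 + be y^2. The form 10 x + y separates the eigenpoints of all the
    examples, so that sorting its values proves that they are distinct. *)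
Lemma near_example_eigenpoints al be ga de (s : seq (R * R)) :
  0 < al * be ->
  sorted <%R [seq 10 * w.1 + w.2 | w <- s] ->
  (forall x y, (x, y) \in s -> [/\ critical_x al be ga de x y = 0,
     critical_y al be ga de x y = 0 & jacobian al be ga de x y != 0]) ->
  (forall x y, critical_x al be ga de x y = 0 -> critical_y al be ga de x y = 0 ->
     (x, y) \in s) ->
  \forall a \near example al be ga de, (eigenpoints (cubic_of a) #= `I_(size s))%card.
Proof.
move=> albe s_sorted s_zero s_complete.
have s_uniq : uniq s by apply: map_uniq; exact: lt_sorted_uniq s_sorted.
apply: (@near_card_eigenpoints R _ _ (tnth (in_tuple s))).
- exact/tuple_uniqP.
- move=> i; have := mem_tnth i (in_tuple s); case: (tnth _ i) => x y.
  by move=> /s_zero[? ? _]; rewrite eigen_x_example eigen_y_example.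
- move=> i; have := mem_tnth i (in_tuple s); case: (tnth _ i) => x y /s_zero[_ _].
  exact: nondegenerate_example.
- move=> x y z v0 ev.
  have z0 : z != 0.
    apply: contraNneq (v0) => z0.
    rewrite -[vec _ _ _ == 0]negbK vec_neq0 z0 eqxx !orbF negb_or !negbK.
    move: ev => [l [_ _]]; rewrite cubic_z_example z0 mulr0 => e.
    have p1 : 0 <= (al * x) ^+ 2 by exact: sqr_ge0.
    have p2 : 0 <= al * be * y ^+ 2 by rewrite mulr_ge0 ?sqr_ge0// ltW.
    have sum0 : (al * x) ^+ 2 + al * be * y ^+ 2 = 0.
      have -> : (al * x) ^+ 2 + al * be * y ^+ 2 = al * (al * x ^+ 2 + be * y ^+ 2) by ring.
      by have -> : al * x ^+ 2 + be * y ^+ 2 = 0; [lra|rewrite mulr0].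
    have /eqP : (al * x) ^+ 2 = 0 by lra.
    have /eqP : al * be * y ^+ 2 = 0 by lra.
    have [al0 be0] : al != 0 /\ be != 0.
      by split; apply: contraTneq albe => ->; rewrite ?mul0r ?mulr0 ltxx.
    by rewrite !(mulf_eq0, sqrf_eq0, orbb) !(negbTE al0) (negbTE be0) => /= -> ->.
  split=> //.
  have /(eigenvector_chart _ (x / z, y / z))[h1 h2] :
      eigenvector (example al be ga de) (x / z) (y / z) 1.
    by have := eigenvectorZ z^-1 ev; rewrite mulVf// ![z^-1 * _]mulrC.
  rewrite eigen_x_example in h1; rewrite eigen_y_example in h2.
  have /(nthP (0, 0))[i si iE] := s_complete _ _ h1 h2.
  by exists (Ordinal si); rewrite (tnth_nth (0, 0)).
Qed.

Lemma circle_coord_le1 x y : x ^+ 2 + y ^+ 2 = 1 -> -1 <= x <= 1.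
Proof. by move=> h; apply/andP; split; nra. Qed.

Lemma positive_definite_example al be ga de x y z : 0 < al -> 0 < be ->
  vec x y z != 0 -> 0 < cubic_z (example al be ga de) x y z.
Proof.
move=> al0 be0; rewrite cubic_z_example vec_neq0 => v0.
have x2 := sqr_ge0 x; have y2 := sqr_ge0 y; have z2 := sqr_ge0 z.
have [h1 h2] : 0 <= al * x ^+ 2 /\ 0 <= be * y ^+ 2 by split; rewrite mulr_ge0// ltW.
case/or3P: v0 => n0.
- by have : 0 < al * x ^+ 2 by [rewrite mulr_gt0// exprn_even_gt0]; lra.
- by have : 0 < be * y ^+ 2 by [rewrite mulr_gt0// exprn_even_gt0]; lra.
- by have : 0 < z ^+ 2 by [rewrite exprn_even_gt0]; lra.
Qed.

Lemma eigenpoints_0_1 : \forall a \near example 1 1 0 0,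
  (eigenpoints (cubic_of a) #= `I_1)%card.
Proof.
apply: (near_example_eigenpoints (s := [:: (0, 0)])).
- by lra.
- by [].
- move=> x y; rewrite !inE => /eqP[-> ->].
  by rewrite /critical_x /critical_y /jacobian; split; [lra|lra|apply/eqP; lra].
- move=> x y; rewrite /critical_x /critical_y => hx hy.
  have x0 : x = 0 by nra.
  have y0 : y = 0 by nra.
  by rewrite x0 y0 !inE !eqxx.
Qed.

Ltac check_sorted := rewrite /= ?andbT; repeat (apply/andP; split); lra.

Ltac check_points :=
  let x := fresh in let y := fresh in
  move=> x y; rewrite !inE;
  repeat (move=> /orP[|]); move=> /eqP[-> ->];
  (rewrite /critical_x /critical_y /jacobian; split; [lra|lra|apply/eqP; lra]).

Lemma mem_pair_eq (x y x' y' : R) (s : seq (R * R)) :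
  (x', y') \in s -> x = x' -> y = y' -> (x, y) \in s.
Proof. by move=> ? -> ->. Qed.

Tactic Notation "at_point" uconstr(u) uconstr(v) :=
  refine (@mem_pair_eq _ _ u v _ _ _ _); [rewrite !inE !eqxx ?orbT|lra|lra].

Lemma eigenpoints_0_3 : \forall a \near example 3 1 0 0,
  (eigenpoints (cubic_of a) #= `I_3)%card.
Proof.
apply: (near_example_eigenpoints (s := [:: (-1, 0); (0, 0); (1, 0)])).
- by lra.
- by check_sorted.
- by check_points.
- move=> x y; rewrite /critical_x /critical_y => hx hy.
  have y0 : y = 0 by nra.
  have /eqP : x * ((x - 1) * (x + 1)) = 0 by rewrite y0 in hx; lra.
  rewrite !mulf_eq0 => /or3P[] /eqP xE.
  + by at_point 0 0.
  + by at_point 1 0.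
  + by at_point (-1) 0.
Qed.

Lemma eigenpoints_0_5 : \forall a \near example 3 (12 / 7) 0 0,
  (eigenpoints (cubic_of a) #= `I_5)%card.
Proof.
apply: (near_example_eigenpoints
  (s := [:: (-1, 0); (0, - 2^-1); (0, 0); (0, 2^-1); (1, 0)])).
- by lra.
- by check_sorted.
- by check_points.
- move=> x y hx hy.
  (* The combination of the two equations is 2 (al - be) x y. *)
  have /eqP : x * y = 0.
    have : y * critical_x 3 (12 / 7) 0 0 x y - x * critical_y 3 (12 / 7) 0 0 x y = 0.
      by rewrite hx hy !mulr0 subrr.
    by rewrite /critical_x /critical_y; lra.
  move: hx hy; rewrite /critical_x /critical_y => hx hy.
  rewrite mulf_eq0 => /orP[] /eqP e; rewrite e in hx hy *.
    have /eqP : y * ((y - 2^-1) * (y + 2^-1)) = 0 by lra.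
    rewrite !mulf_eq0 => /or3P[] /eqP yE.
    + by at_point 0 0.
    + by at_point 0 2^-1.
    + by at_point 0 (- 2^-1).
  have /eqP : x * ((x - 1) * (x + 1)) = 0 by lra.
  rewrite !mulf_eq0 => /or3P[] /eqP xE.
  + by at_point 0 0.
  + by at_point 1 0.
  + by at_point (-1) 0.
Qed.

Lemma eigenpoints_0_7 : \forall a \near example (9 / 2) (9 / 2) 2^-1 (3 / 2),
  (eigenpoints (cubic_of a) #= `I_7)%card.
Proof.
apply: (near_example_eigenpoints
  (s := [:: (-1, 0); (- (2 / 3), - (2 / 3)); (- (2 / 3), 2 / 3); (0, 0); (1, -1);
            (1, 1); (4 / 3, 0)])).
- by lra.
- by check_sorted.
- by check_points.
- move=> x y; rewrite /critical_x /critical_y => hx /eqP; rewrite mulf_eq0.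
  move=> /orP[] /eqP hy.
    rewrite hy in hx *.
    have /eqP : x * ((x - 4 / 3) * (x + 1)) = 0 by lra.
    rewrite !mulf_eq0 => /or3P[] /eqP xE.
    + by at_point 0 0.
    + by at_point (4 / 3) 0.
    + by at_point (-1) 0.
  (* Off the axis the second equation turns the first into y^2 = x^2. *)
  have q : 9 / 2 * x ^+ 2 + 9 / 2 * y ^+ 2 + 3 = 3 * x + 9 by lra.
  rewrite q in hx.
  have /eqP : (y - x) * (y + x) = 0 by lra.
  have /eqP : (x - 1) * (x + 2 / 3) = 0 by lra.
  rewrite !mulf_eq0 => /orP[] /eqP xE /orP[] /eqP yE.
  + by at_point 1 1.
  + by at_point 1 (-1).
  + by at_point (- (2 / 3)) (- (2 / 3)).
  + by at_point (- (2 / 3)) (2 / 3).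
Qed.

Lemma eigenpoints_1_3 : \forall a \near example (-3) (-3) 2^-1 2^-1,
  (eigenpoints (cubic_of a) #= `I_3)%card.
Proof.
apply: (near_example_eigenpoints (s := [:: (-2, 0); (0, 0); (3 / 2, 0)])).
- by lra.
- by check_sorted.
- by check_points.
- move=> x y; rewrite /critical_x /critical_y => hx hy.
  have y0 : y = 0.
    move: hy => /eqP; rewrite mulf_eq0 => /orP[/eqP//|/eqP hy].
    have q : - 3 * x ^+ 2 + - 3 * y ^+ 2 + 3 = x - 6 by lra.
    rewrite q in hx.
    have : x ^+ 2 + y ^+ 2 = 0 by lra.
    by nra.
  rewrite y0 in hx *.
  have /eqP : x * ((x - 3 / 2) * (x + 2)) = 0 by lra.
  rewrite !mulf_eq0 => /or3P[] /eqP xE.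
  + by at_point 0 0.
  + by at_point (3 / 2) 0.
  + by at_point (-2) 0.
Qed.

Lemma eigenpoints_1_5 : \forall a \near example (- (3 / 2)) (-12) 0 0,
  (eigenpoints (cubic_of a) #= `I_5)%card.
Proof.
apply: (near_example_eigenpoints
  (s := [:: (-2, 0); (0, - (3 / 2)); (0, 0); (0, 3 / 2); (2, 0)])).
- by lra.
- by check_sorted.
- by check_points.
- move=> x y hx hy.
  (* The combination of the two equations is 2 (al - be) x y. *)
  have /eqP : x * y = 0.
    have : y * critical_x (- (3 / 2)) (-12) 0 0 x y
        - x * critical_y (- (3 / 2)) (-12) 0 0 x y = 0.
      by rewrite hx hy !mulr0 subrr.
    by rewrite /critical_x /critical_y; lra.
  move: hx hy; rewrite /critical_x /critical_y => hx hy.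
  rewrite mulf_eq0 => /orP[] /eqP e; rewrite e in hx hy *.
    have /eqP : y * ((y - 3 / 2) * (y + 3 / 2)) = 0 by lra.
    rewrite !mulf_eq0 => /or3P[] /eqP yE.
    + by at_point 0 0.
    + by at_point 0 (3 / 2).
    + by at_point 0 (- (3 / 2)).
  have /eqP : x * ((x - 2) * (x + 2)) = 0 by lra.
  rewrite !mulf_eq0 => /or3P[] /eqP xE.
  + by at_point 0 0.
  + by at_point 2 0.
  + by at_point (-2) 0.
Qed.

Lemma eigenpoints_1_7 : \forall a \near example (-3) (-3) 2^-1 (3 / 2),
  (eigenpoints (cubic_of a) #= `I_7)%card.
Proof.
apply: (near_example_eigenpoints
  (s := [:: (-2, 0); (- (3 / 2), - (3 / 2)); (- (3 / 2), 3 / 2); (0, 0); (1, -1);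
            (1, 1); (3 / 2, 0)])).
- by lra.
- by check_sorted.
- by check_points.
- move=> x y; rewrite /critical_x /critical_y => hx /eqP; rewrite mulf_eq0.
  move=> /orP[] /eqP hy.
    rewrite hy in hx *.
    have /eqP : x * ((x - 3 / 2) * (x + 2)) = 0 by lra.
    rewrite !mulf_eq0 => /or3P[] /eqP xE.
    + by at_point 0 0.
    + by at_point (3 / 2) 0.
    + by at_point (-2) 0.
  (* Off the axis the second equation turns the first into y^2 = x^2. *)
  have q : - 3 * x ^+ 2 + - 3 * y ^+ 2 + 3 = 3 * x - 6 by lra.
  rewrite q in hx.
  have /eqP : (y - x) * (y + x) = 0 by lra.
  have /eqP : (x - 1) * (x + 3 / 2) = 0 by lra.
  rewrite !mulf_eq0 => /orP[] /eqP xE /orP[] /eqP yE.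
  + by at_point 1 1.
  + by at_point 1 (-1).
  + by at_point (- (3 / 2)) (- (3 / 2)).
  + by at_point (- (3 / 2)) (3 / 2).
Qed.

Lemma near_example_no_oval al be ga de : 0 < al -> 0 < be ->
  \forall a \near example al be ga de, has_ovals 0 (cubic_of a).
Proof.
by move=> al0 be0; apply: near_has_no_oval => x y z; exact: positive_definite_example.
Qed.

Lemma one_oval_1_3 :
  \forall a \near example (-3) (-3) 2^-1 2^-1, has_ovals 1 (cubic_of a).
Proof.
apply: near_has_one_oval => [|x y xy|x y xy]; first by rewrite coef_example.
  rewrite cubic_example; have /andP[x1 x2] := circle_coord_le1 xy.
  have yE : y ^+ 2 = 1 - x ^+ 2 by lra.
  by rewrite yE; lra.
rewrite cubic_example; have /andP[x1 x2] := circle_coord_le1 xy.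
have yE : y ^+ 2 = 1 - x ^+ 2 by lra.
by rewrite yE; lra.
Qed.

Lemma one_oval_1_5 :
  \forall a \near example (- (3 / 2)) (-12) 0 0, has_ovals 1 (cubic_of a).
Proof.
apply: near_has_one_oval => [|x y xy|x y xy]; first by rewrite coef_example.
  rewrite cubic_example; have y2 := sqr_ge0 y.
  have xE : x ^+ 2 = 1 - y ^+ 2 by lra.
  by rewrite xE; lra.
rewrite cubic_example; have x2 := sqr_ge0 x.
have yE : y ^+ 2 = 1 - x ^+ 2 by lra.
by rewrite yE; lra.
Qed.

Lemma one_oval_1_7 :
  \forall a \near example (-3) (-3) 2^-1 (3 / 2), has_ovals 1 (cubic_of a).
Proof.
have bound x y : x ^+ 2 + y ^+ 2 = 1 -> -2 < x * (3 / 2 - x ^+ 2) < 2.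
  by move=> xy; have := circle_coord_le1 xy; have := sqr_ge0 x; have := sqr_ge0 y; nra.
apply: near_has_one_oval => [|x y xy|x y xy]; first by rewrite coef_example.
  rewrite cubic_example; have /andP[x1 x2] := bound _ _ xy.
  have yE : y ^+ 2 = 1 - x ^+ 2 by lra.
  by rewrite yE; lra.
rewrite cubic_example; have /andP[x1 x2] := bound _ _ xy.
have yE : y ^+ 2 = 1 - x ^+ 2 by lra.
by rewrite yE; lra.
Qed.

End Examples.

Theorem proposition5p1 (R : realType) (c t : nat) (hc : c = 0%N \/ c = 1%N)
    (ht_odd : odd t) (ht_ge : (2 * c + 1 <= t)%N) (ht_le : (t <= 7)%N) :
  positive_volume
    [set f : ternary_cubic R | has_ovals c f /\ (eigenpoints f #= `I_t)%card].
Proof.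
suff [a0 [ovals eigen]] : exists a0 : 'rV[R]_10,
    (\forall a \near a0, has_ovals c (cubic_of a)) /\
    (\forall a \near a0, (eigenpoints (cubic_of a) #= `I_t)%card).
  by apply: (positive_volume_near (a0 := a0)); exact: nbhsI ovals eigen.
have : t \in [:: 1; 3; 5; 7]%N.
  by move: t ht_odd ht_le {ht_ge} => [|[|[|[|[|[|[|[|//]]]]]]]].
rewrite !inE; case: hc ht_ge => -> ht_ge /or4P[] /eqP tE;
  rewrite {}tE // in ht_ge *.
- exists (example 1 1 0 0); split; last exact: eigenpoints_0_1.
  by apply: near_example_no_oval; lra.
- exists (example 3 1 0 0); split; last exact: eigenpoints_0_3.
  by apply: near_example_no_oval; lra.
- exists (example 3 (12 / 7) 0 0); split; last exact: eigenpoints_0_5.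
  by apply: near_example_no_oval; lra.
- exists (example (9 / 2) (9 / 2) 2^-1 (3 / 2)); split; last exact: eigenpoints_0_7.
  by apply: near_example_no_oval; lra.
- by exists (example (-3) (-3) 2^-1 2^-1); split; [exact: one_oval_1_3|exact: eigenpoints_1_3].
- by exists (example (- (3 / 2)) (-12) 0 0); split; [exact: one_oval_1_5|exact: eigenpoints_1_5].
- by exists (example (-3) (-3) 2^-1 (3 / 2)); split; [exact: one_oval_1_7|exact: eigenpoints_1_7].
Qed.
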